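(* The problem of computing, for a given string $S$, a minimum-cardinality $2$-sharp attractor of $S$ is solvable in polynomial time.
   Context: A $k$-sharp attractor of a string $S\in\Sigma^n$ is a set $\Gamma\subseteq[1..n]$ such that every substring $S[i..j]$ with $j-i+1=k$ has an occurrence $S[i'..j']=S[i..j]$ with $j''\in[i'..j']$ for some $j''\in\Gamma$. *)

(* Defs.v *)
From mathcomp Require Import all_boot finmap.

Set Implicit Arguments.
Unset Strict Implicit.
Unset Printing Implicit Defensive.

(* Positions are 1-based: [substring S i j] is S[i..j], for
   1 <= i <= j <= size S. *)
Definition substring (T : Type) (S : seq T) (i j : nat) : seq T :=
  drop i.-1 (take j S).

Definition sharp_attractor (T : Type) (k : nat) (S : seq T)
    (Gamma : {fset nat}) : Prop :=
  (forall g : nat, g \in Gamma -> 1 <= g <= size S) /\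
  (forall i j : nat, 1 <= i -> i <= j -> j <= size S -> j - i + 1 = k ->
     exists i' j' : nat,
       [/\ 1 <= i', i' <= j', j' <= size S,
           substring S i' j' = substring S i j
         & exists2 j'' : nat, j'' \in Gamma & i' <= j'' <= j']).

Definition minimum_sharp_attractor (T : Type) (k : nat) (S : seq T)
    (Gamma : {fset nat}) : Prop :=
  sharp_attractor k S Gamma /\
  (forall Gamma' : {fset nat},
     sharp_attractor k S Gamma' -> #|` Gamma| <= #|` Gamma'|).

(* Random access machine with a read-only, randomly accessible input, an
   append-only output, and registers indexed by nat holding natural numbers.
   Every instruction costs one time unit.  As the only arithmetic is addition
   and truncated subtraction, the maximal bit length of inputs and register contents grows
   by O(1) per step, so this unit cost is polynomially related to Turing machine
   time (Cook-Reckhow 1973; Papadimitriou, Computational Complexity,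
   Section 2.6).  In the table, [a] is the content of register a. *)
Inductive instr : Type :=
| Iconst of nat & nat        (* Iconst r c     r := c                      *)
| Imove of nat & nat         (* Imove r a      r := [a]                    *)
| Iadd of nat & nat & nat    (* Iadd r a b     r := [a] + [b]              *)
| Isub of nat & nat & nat    (* Isub r a b     r := [a] - [b], truncated   *)
| Iload of nat & nat         (* Iload r a      r := [[a]]                  *)
| Istore of nat & nat        (* Istore a b     register [a] := [b]         *)
| Ilen of nat                (* Ilen r         r := length of the input    *)
| Iread of nat & nat         (* Iread r a      r := input item [a] (from 0) *)
| Iwrite of nat              (* Iwrite a       append [a] to the output    *)
| Ijump of nat               (* Ijump l        go to instruction l         *)
| Ijumplt of nat & nat & nat (* Ijumplt a b l  go to l if [a] < [b]        *)
| Ihalt.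

Definition program : Type := seq instr.

Record config : Type :=
  Config { pc : nat; regs : nat -> nat; output : seq nat }.

Definition init : config := Config 0 (fun _ => 0) [::].

Definition upd (m : nat -> nat) (r v : nat) : nat -> nat :=
  fun x => if x == r then v else m x.

(* Leaving the program also halts. *)
Definition current (p : program) (c : config) : instr := nth Ihalt p (pc c).

Definition halted (p : program) (c : config) : bool :=
  if current p c is Ihalt then true else false.

Definition step (p : program) (input : seq nat) (c : config) : config :=
  let: Config i m o := c in
  match current p c with
  | Iconst r v => Config i.+1 (upd m r v) o
  | Imove r a => Config i.+1 (upd m r (m a)) o
  | Iadd r a b => Config i.+1 (upd m r (m a + m b)) o
  | Isub r a b => Config i.+1 (upd m r (m a - m b)) o
  | Iload r a => Config i.+1 (upd m r (m (m a))) o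
  | Istore a b => Config i.+1 (upd m (m a) (m b)) o
  | Ilen r => Config i.+1 (upd m r (size input)) o
  | Iread r a => Config i.+1 (upd m r (nth 0 input (m a))) o
  | Iwrite a => Config i.+1 m (rcons o (m a))
  | Ijump l => Config l m o
  | Ijumplt a b l => Config (if m a < m b then l else i.+1) m o
  | Ihalt => c
  end.

Definition run (p : program) (input : seq nat) (t : nat) : config :=
  iter t (step p input) init.

(* Total bit length of the input numbers, 0 counting for one bit. *)
Definition input_size (input : seq nat) : nat :=
  \sum_(s <- input) (trunc_log 2 s).+1.

Definition polytime_solvable (R : seq nat -> seq nat -> Prop) : Prop :=
  exists (p : program) (c d : nat), forall input : seq nat,
    exists t : nat,
      [/\ t <= c * input_size input ^ d + c,
          halted p (run p input t)
        & R input (output (run p input t))].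

(* Letters are arbitrary natural numbers, so the alphabet is not fixed: for an
   alphabet of constant size the problem could be solved by brute force over
   the boundedly many length-k substrings.  The solution is written as a
   duplicate-free list of positions, in any order. *)
Definition compute_minimum_sharp_attractor (k : nat) (S out : seq nat) : Prop :=
  uniq out /\ minimum_sharp_attractor k S [fset x in out]%fset.

(* Main.v *)
Require Import Defs.
From mathcomp Require Import all_boot finmap.
From mathcomp Require Import zify.

Set Implicit Arguments.
Unset Strict Implicit.
Unset Printing Implicit Defensive.

(** Take the distinct bigrams of S as vertices; an inner position of S joins the two
    bigrams that overlap in it, and a 2-sharp attractor is an edge cover of this graph.
    Hence a minimum attractor has (number of bigrams) - (size of a maximum matching)
    elements, and the graph need not be bipartite.

    Maximum matchings are found without blossoms, by an algorithmic form of Gallai's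
    lemma.  A matching is an involution of the vertices whose fixed points are the
    unmatched vertices.  For all quadruples X of vertices the program keeps the best
    known matching that avoids X, and improves these by adding an edge between two
    unmatched vertices and by exchanging two known matchings along an alternating path.
    The table can improve only polynomially often.  When it is stable, let f be the
    least number of unmatched vertices of a known matching, D the set of vertices left
    unmatched by some known matching with f unmatched vertices, and A the set of
    neighbours of D outside D.  Then every component of D contains at most one vertex
    that an optimal known matching leaves unmatched or matches into A, and these
    components with A form a Tutte-Berge certificate of maximality.

    The program is written in a language with arrays, whose only loop repeats its body
    (length of the input) + 1 times, so that every program runs in polynomial time. *)


(** * A loop language and its compiler *)

(** Gallai's argument exchanges a maximum matching with another one that avoids a prescribed vertex.
    A program cannot range over all matchings, so one is stored for each demand to avoid certain
    vertices, and a stable table yields only inequalities: what an exchange or an added edge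
    produces, after deleting the edges at four or fewer vertices, is no better than the matching
    stored for those vertices.

    These inequalities give the bound f + 2|X| on the number of unmatched vertices of a known
    matching that avoids a set X of at most two vertices of A. For one vertex this is parity; for
    two it needs an exchange. Against this bound an alternating walk shows that no known matching
    attaining it avoids X and two vertices of one component of D.

    So if a component contains a vertex that the optimal known matching leaves unmatched or matches
    into A, it contains exactly one, and the rest of the component is matched within itself. The
    component is odd, and therefore every matching, known or not, must leave one of its vertices
    unmatched or match one into A. Counting these vertices gives the certificate. *)

Inductive expr : Type :=
| Const of nat
| Len
| Input of expr
| Get of nat & expr
| Plus of expr & expr
| Minus of expr & expr.

Inductive cmd : Type :=
| Skip
| Store of nat & expr & expr
| Seq of cmd & cmd
| If of expr & expr & cmd & cmd
| Rep of cmd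
| Write of expr.

Record state : Type := State { arr : nat -> nat -> nat; out : seq nat }.

Definition set_arr (s : state) (a i v : nat) : state :=
  State (fun a' i' => if (a' == a) && (i' == i) then v else arr s a' i') (out s).

Section Semantics.
Variable inp : seq nat.

Fixpoint eval (e : expr) (s : state) : nat :=
  match e with
  | Const c => c
  | Len => size inp
  | Input e => nth 0 inp (eval e s)
  | Get a e => arr s a (eval e s)
  | Plus e1 e2 => eval e1 s + eval e2 s
  | Minus e1 e2 => eval e1 s - eval e2 s
  end.

Fixpoint sem (c : cmd) (s : state) : state :=
  match c with
  | Skip => s
  | Store a e1 e2 => set_arr s a (eval e1 s) (eval e2 s)
  | Seq c1 c2 => sem c2 (sem c1 s)
  | If e1 e2 c1 c2 => if eval e1 s < eval e2 s then sem c1 s else sem c2 s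
  | Rep c => iter (size inp).+1 (sem c) s
  | Write e => State (arr s) (rcons (out s) (eval e s))
  end.

End Semantics.

Section Compiler.

(* Register [K * j] is the [j]-th temporary, and register [K * i + a.+1] holds
   item [i] of array [a]; hence array names must satisfy [a.+1 < K]. *)
Variable K : nat.

Definition temp (j : nat) : nat := K * j.
Definition cell (a i : nat) : nat := K * i + a.+1.

(** The machine cannot multiply, so [K] copies of one addition produce [K * i]. *)
Definition address (a d d' : nat) : program :=
  Iconst (temp d') a.+1 :: nseq K (Iadd (temp d') (temp d') (temp d)).

Fixpoint compile_expr (e : expr) (d : nat) : program :=
  match e with
  | Const c => [:: Iconst (temp d) c]
  | Len => [:: Ilen (temp d)]
  | Input e => compile_expr e d ++ [:: Iread (temp d) (temp d)]
  | Get a e => compile_expr e d ++ address a d d.+1 ++ [:: Iload (temp d) (temp d.+1)]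
  | Plus e1 e2 =>
      compile_expr e1 d ++ compile_expr e2 d.+1 ++ [:: Iadd (temp d) (temp d) (temp d.+1)]
  | Minus e1 e2 =>
      compile_expr e1 d ++ compile_expr e2 d.+1 ++ [:: Isub (temp d) (temp d) (temp d.+1)]
  end.

Fixpoint expr_ok (e : expr) : bool :=
  match e with
  | Const _ | Len => true
  | Input e => expr_ok e
  | Get a e => (a.+1 < K) && expr_ok e
  | Plus e1 e2 | Minus e1 e2 => expr_ok e1 && expr_ok e2
  end.

Fixpoint cmd_ok (c : cmd) : bool :=
  match c with
  | Skip => true
  | Store a e1 e2 => [&& a.+1 < K, expr_ok e1 & expr_ok e2]
  | Seq c1 c2 => cmd_ok c1 && cmd_ok c2
  | If e1 e2 c1 c2 => [&& expr_ok e1, expr_ok e2, cmd_ok c1 & cmd_ok c2]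
  | Rep c => cmd_ok c
  | Write e => expr_ok e
  end.

(* [compile c d l] is position dependent: it is meant to be placed at [l]. *)
Fixpoint compile (c : cmd) (d l : nat) : program :=
  match c with
  | Skip => [::]
  | Store a e1 e2 =>
      compile_expr e1 d ++ compile_expr e2 d.+1 ++ address a d d.+2 ++
      [:: Istore (temp d.+2) (temp d.+1)]
  | Seq c1 c2 => let p1 := compile c1 d l in p1 ++ compile c2 d (l + size p1)
  | If e1 e2 c1 c2 =>
      let pe := compile_expr e1 d ++ compile_expr e2 d.+1 in
      let p2 := compile c2 d (l + size pe).+1 in
      let l1 := (l + size pe + size p2).+2 in
      let p1 := compile c1 d l1 in
      pe ++ [:: Ijumplt (temp d) (temp d.+1) l1] ++ p2 ++
      [:: Ijump (l1 + size p1)] ++ p1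
  | Rep c =>
      let p := compile c d.+1 (l + 8) in
      [:: Ilen (temp d); Iconst (temp d.+1) 1; Iadd (temp d) (temp d) (temp d.+1);
          Iconst (temp d.+1) 0; Ijumplt (temp d.+1) (temp d) (l + 6);
          Ijump (l + 8 + size p).+1;
          Iconst (temp d.+1) 1; Isub (temp d) (temp d) (temp d.+1)] ++
      p ++ [:: Ijump (l + 3)]
  | Write e => compile_expr e d ++ [:: Iwrite (temp d)]
  end.

(** Only an upper bound: [If] is charged for both branches. A loop spends 3 instructions on its
    set-up, 3 on leaving, and 4 before and 1 after each run of the body. *)
Fixpoint time (c : cmd) (N : nat) : nat :=
  match c with
  | Skip => 0
  | Store _ _ _ | Write _ => size (compile c 0 0)
  | Seq c1 c2 => time c1 N + time c2 N
  | If e1 e2 c1 c2 =>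
      size (compile_expr e1 0 ++ compile_expr e2 0) + 2 + time c1 N + time c2 N
  | Rep c => 6 + N * (5 + time c N)
  end.

Lemma time_poly (c : cmd) :
  exists C d, forall N, 0 < N -> time c N <= C * N ^ d.
Proof.
elim: c => [|a e1 e2|c1 [C1 [d1 H1]] c2 [C2 [d2 H2]]|e1 e2 c1 [C1 [d1 H1]] c2 [C2 [d2 H2]]
           |c [C [d H]]|e].
- by exists 0, 0.
- by exists (time (Store a e1 e2) 0), 0 => N _; rewrite expn0 muln1.
- exists (C1 + C2), (d1 + d2) => N N0 /=.
  rewrite mulnDl leq_add //.
    by apply: leq_trans (H1 N N0) _; rewrite leq_mul2l leq_pexp2l ?orbT ?leq_addr.
  by apply: leq_trans (H2 N N0) _; rewrite leq_mul2l leq_pexp2l ?orbT ?leq_addl.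
- set C0 := size (compile_expr e1 0 ++ compile_expr e2 0) + 2.
  exists (C0 + C1 + C2), (d1 + d2) => N N0 /=.
  rewrite !mulnDl; apply: leq_add; first apply: leq_add.
  + by rewrite -[X in X <= _]muln1 -mulnDl leq_mul2l expn_gt0 N0 orbT.
  + by apply: leq_trans (H1 N N0) _; rewrite leq_mul2l leq_pexp2l ?orbT ?leq_addr.
  + by apply: leq_trans (H2 N N0) _; rewrite leq_mul2l leq_pexp2l ?orbT ?leq_addl.
- exists (11 + C), d.+1 => N N0 /=; have := H N N0.
  have : 0 < N ^ d by rewrite expn_gt0 N0.
  rewrite expnS; move: (N ^ d) (time c N) => X t; nia.
- by exists (time (Write e) 0), 0 => N _; rewrite expn0 muln1.
Qed.

Lemma size_compile_expr e d d' : size (compile_expr e d) = size (compile_expr e d').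
Proof.
elim: e d d' => //= [e IH|a e IH|e1 IH1 e2 IH2|e1 IH1 e2 IH2] d d';
  rewrite !size_cat /= ?(IH d d') ?(IH1 d d') ?(IH2 d.+1 d'.+1) //.
by rewrite !size_cat /address /= !size_nseq.
Qed.

Variable inp : seq nat.

Definition represents (m : nat -> nat) (s : state) : Prop :=
  forall a i, a.+1 < K -> m (cell a i) = arr s a i.

(** Temporaries below [d] are live: they hold first operands already evaluated and the counters of
    enclosing loops. *)
Definition agree_below (d : nat) (m m' : nat -> nat) : Prop :=
  forall j, j < d -> m' (temp j) = m (temp j).

Definition placed (p : program) (l : nat) (q : program) : Prop :=
  forall i, i < size q -> nth Ihalt p (l + i) = nth Ihalt q i.

Lemma placed_cat p l q1 q2 :
  placed p l (q1 ++ q2) <-> placed p l q1 /\ placed p (l + size q1) q2.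
Proof.
split=> [H|[H1 H2]]; last first.
  move=> i; rewrite size_cat nth_cat => lti.
  by case: ltnP => hi; [exact: H1 | rewrite -H2; [congr nth; lia|lia]].
split=> i lti; have := H _.
  by move=> /(_ i); rewrite size_cat nth_cat lti; apply; lia.
move=> /(_ (size q1 + i)); rewrite size_cat nth_cat ltn_add2l lti addnA.
by rewrite [size q1 + i < size q1]ltnNge leq_addr /= addKn; apply.
Qed.

Lemma placed_cons p l x q :
  placed p l (x :: q) <-> nth Ihalt p l = x /\ placed p l.+1 q.
Proof.
rewrite -cat1s placed_cat /= addn1; split=> -[H1 H2]; split=> //.
  by have := H1 0 isT; rewrite addn0.
by case=> // _; rewrite addn0.
Qed.

Definition exec (p : program) (t : nat) (c : config) : config := iter t (step p inp) c.
Arguments exec : simpl never.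

Lemma execD p t1 t2 c : exec p (t1 + t2) c = exec p t2 (exec p t1 c).
Proof. by rewrite addnC /exec iterD. Qed.

Hypothesis K_gt0 : 0 < K.

Lemma temp_inj i j : (temp i == temp j) = (i == j).
Proof. by rewrite /temp eqn_pmul2l. Qed.

Lemma cell_temp a i j : a.+1 < K -> (cell a i == temp j) = false.
Proof.
move=> aK; apply/eqP => /(congr1 (modn^~ K)); rewrite /cell /temp /=.
by rewrite mulnC modnMDl modn_small // modnMr.
Qed.

Lemma cell_inj a i b j : a.+1 < K -> b.+1 < K ->
  (cell a i == cell b j) = (a == b) && (i == j).
Proof.
move=> aK bK; apply/eqP/andP => [|[/eqP-> /eqP->]] //.
rewrite /cell => H.
have ab : a.+1 = b.+1.
  by move/(congr1 (modn^~ K)): (H); rewrite ![K * _]mulnC !modnMDl !modn_small.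
move: H; rewrite ab => /addIn/eqP; rewrite eqn_pmul2l // => /eqP->.
by case: ab => ->.
Qed.

Lemma represents_upd_temp m s j v : represents m s -> represents (upd m (temp j) v) s.
Proof. by move=> H a i aK; rewrite /upd cell_temp // H. Qed.

Lemma represents_set m s a i v : a.+1 < K -> represents m s ->
  represents (upd m (cell a i) v) (set_arr s a i v).
Proof. by move=> aK H b j bK; rewrite /upd cell_inj //= H. Qed.

Lemma agree_below_upd d m m' j v : d <= j ->
  agree_below d m m' -> agree_below d m (upd m' (temp j) v).
Proof.
move=> dj H i id; rewrite /upd temp_inj; case: eqP => [ij|_]; [lia|exact: H].
Qed.

Lemma agree_below_trans d d' m1 m2 m3 : d <= d' ->
  agree_below d m1 m2 -> agree_below d' m2 m3 -> agree_below d m1 m3.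
Proof. by move=> dd H1 H2 j jd; rewrite H2 ?H1 // (leq_trans jd). Qed.

Lemma exec_add_const p l m o d d' k : d != d' ->
  placed p l (nseq k (Iadd (temp d') (temp d') (temp d))) ->
  exists m', [/\ exec p k (Config l m o) = Config (l + k) m' o,
    m' (temp d') = m (temp d') + k * m (temp d)
    & forall x, x != temp d' -> m' x = m x].
Proof.
move=> dd'; elim: k l m => [|k IH] l m.
  by exists m; rewrite addn0 mul0n addn0.
case/placed_cons => Hl Hp.
have [m' [E1 E2 E3]] := IH _ (upd m (temp d') (m (temp d') + m (temp d))) Hp.
exists m'; split.
- rewrite /exec iterSr /= /current /= Hl -/(exec p k _) E1; congr Config; lia.
- by rewrite E2 /upd eqxx temp_inj (negPf dd') mulSn addnA.
- by move=> x xd; rewrite E3 // /upd (negPf xd).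
Qed.

Lemma exec_address p l m o a d d' : d != d' ->
  placed p l (address a d d') ->
  exists m', [/\ exec p K.+1 (Config l m o) = Config (l + K.+1) m' o,
    m' (temp d') = cell a (m (temp d))
    & forall x, x != temp d' -> m' x = m x].
Proof.
move=> dd' /placed_cons[Hl Hp].
have [m' [E1 E2 E3]] := exec_add_const (upd m (temp d') a.+1) o dd' Hp.
exists m'; split.
- rewrite /exec iterSr /= /current /= Hl -/(exec p K _) E1; congr Config; lia.
- by rewrite E2 /upd eqxx temp_inj (negPf dd') /cell addnC.
- by move=> x xd; rewrite E3 // /upd (negPf xd).
Qed.

Lemma represents_frame m m' s j : represents m s ->
  (forall x, x != temp j -> m' x = m x) -> represents m' s.
Proof. by move=> H E a i aK; rewrite E ?H // cell_temp. Qed.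

Lemma agree_below_frame d m m' j : d <= j ->
  (forall x, x != temp j -> m' x = m x) -> agree_below d m m'.
Proof. by move=> dj E i id; rewrite E // temp_inj; apply/eqP => ij; lia. Qed.

Lemma exec1 p c : exec p 1 c = step p inp c. Proof. by []. Qed.

Lemma execS p t c : exec p t.+1 c = exec p t (step p inp c).
Proof. by rewrite /exec iterSr. Qed.

Lemma compile_expr_correct e p d l m o s :
  expr_ok e -> placed p l (compile_expr e d) -> represents m s ->
  exists m', [/\ exec p (size (compile_expr e d)) (Config l m o) =
                   Config (l + size (compile_expr e d)) m' o,
    m' (temp d) = eval inp e s, represents m' s & agree_below d m m'].
Proof.
elim: e d l m => [c||e IH|a e IH|e1 IH1 e2 IH2|e1 IH1 e2 IH2] d l m /=.
- move=> _ /placed_cons[Hl _] Hm; exists (upd m (temp d) c).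
  rewrite /exec /= /current /= Hl addn1; split=> //.
  + by rewrite /upd eqxx.
  + exact: represents_upd_temp.
  + exact: agree_below_upd.
- move=> _ /placed_cons[Hl _] Hm; exists (upd m (temp d) (size inp)).
  rewrite /exec /= /current /= Hl addn1; split=> //.
  + by rewrite /upd eqxx.
  + exact: represents_upd_temp.
  + exact: agree_below_upd.
- move=> eok /placed_cat[Hp /placed_cons[Hl _]] Hm.
  have [m' [E1 E2 E3 E4]] := IH _ _ _ eok Hp Hm.
  exists (upd m' (temp d) (nth 0 inp (m' (temp d)))).
  rewrite size_cat execD E1 exec1 /= /current /= Hl addnA addn1; split=> //.
  + by rewrite /upd eqxx E2.
  + exact: represents_upd_temp.
  + exact: agree_below_upd.
- move=> /andP[aK eok] /placed_cat[Hp Hal].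
  have szA : size (address a d d.+1) = K.+1 by rewrite /address /= size_nseq.
  have /placed_cat[Ha] : placed p (l + size (compile_expr e d))
    (address a d d.+1 ++ [:: Iload (temp d) (temp d.+1)]) := Hal.
  rewrite szA => /placed_cons[Hl _] Hm.
  have [m1 [E1 E2 E3 E4]] := IH _ _ _ eok Hp Hm.
  have dd : d != d.+1 by rewrite neq_ltn ltnSn.
  have [m2 [F1 F2 F3]] := exec_address m1 o dd Ha.
  exists (upd m2 (temp d) (m2 (m2 (temp d.+1)))).
  have F4 := represents_frame E3 F3.
  rewrite size_cat (_ : size (Iconst _ _ :: _) = K.+1 + 1); last by rewrite /= size_cat size_nseq.
  rewrite !execD E1 F1 exec1 /= /current /= Hl !addnA addn1; split=> //.
  + by rewrite /upd eqxx F2 F4 // E2.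
  + exact: represents_upd_temp.
  + apply: agree_below_upd => //; apply: agree_below_trans (leqnn d) E4 _.
    exact: agree_below_frame F3.
- move=> /andP[ok1 ok2] /placed_cat[Hp1 /placed_cat[Hp2 /placed_cons[Hl _]]] Hm.
  have [m1 [E1 E2 E3 E4]] := IH1 _ _ _ ok1 Hp1 Hm.
  have [m2 [F1 F2 F3 F4]] := IH2 _ _ _ ok2 Hp2 E3.
  exists (upd m2 (temp d) (m2 (temp d) + m2 (temp d.+1))).
  rewrite 2!size_cat !execD E1 F1 exec1 /= /current /= Hl !addnA addn1; split=> //.
  + by rewrite /upd eqxx F2 F4 // E2.
  + exact: represents_upd_temp.
  + apply: agree_below_upd => //; exact: agree_below_trans (leqnSn d) E4 F4.
- move=> /andP[ok1 ok2] /placed_cat[Hp1 /placed_cat[Hp2 /placed_cons[Hl _]]] Hm.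
  have [m1 [E1 E2 E3 E4]] := IH1 _ _ _ ok1 Hp1 Hm.
  have [m2 [F1 F2 F3 F4]] := IH2 _ _ _ ok2 Hp2 E3.
  exists (upd m2 (temp d) (m2 (temp d) - m2 (temp d.+1))).
  rewrite 2!size_cat !execD E1 F1 exec1 /= /current /= Hl !addnA addn1; split=> //.
  + by rewrite /upd eqxx F2 F4 // E2.
  + exact: represents_upd_temp.
  + apply: agree_below_upd => //; exact: agree_below_trans (leqnSn d) E4 F4.
Qed.

Lemma compile_expr2_correct e1 e2 p d l m o s :
  expr_ok e1 -> expr_ok e2 ->
  placed p l (compile_expr e1 d ++ compile_expr e2 d.+1) -> represents m s ->
  let k := size (compile_expr e1 d ++ compile_expr e2 d.+1) in
  exists m', [/\ exec p k (Config l m o) = Config (l + k) m' o,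
    m' (temp d) = eval inp e1 s, m' (temp d.+1) = eval inp e2 s,
    represents m' s & agree_below d m m'].
Proof.
move=> ok1 ok2 /placed_cat[Hp1 Hp2] Hm /=.
have [m1 [E1 E2 E3 E4]] := compile_expr_correct o ok1 Hp1 Hm.
have [m2 [F1 F2 F3 F4]] := compile_expr_correct o ok2 Hp2 E3.
exists m2; rewrite size_cat execD E1 F1 addnA F4 //; split=> //.
exact: agree_below_trans (leqnSn d) E4 F4.
Qed.

Lemma compile_correct c p d l m s :
  cmd_ok c -> placed p l (compile c d l) -> represents m s ->
  exists t m', [/\ t <= time c (size inp).+1,
    exec p t (Config l m (out s)) =
      Config (l + size (compile c d l)) m' (out (sem inp c s)),
    represents m' (sem inp c s) & agree_below d m m'].
Proof.
elim: c d l m s => [|a e1 e2|c1 IH1 c2 IH2|e1 e2 c1 IH1 c2 IH2|c IH|e] d l m s.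
- by move=> _ _ Hm; exists 0, m; rewrite addn0.
- rewrite [cmd_ok _]/= => /and3P[aK ok1 ok2].
  have -> : compile (Store a e1 e2) d l = (compile_expr e1 d ++ compile_expr e2 d.+1) ++
    address a d d.+2 ++ [:: Istore (temp d.+2) (temp d.+1)] by rewrite -catA.
  move=> /placed_cat[Hp /placed_cat[Ha]].
  have szA : size (address a d d.+2) = K.+1 by rewrite /address /= size_nseq.
  rewrite szA => /placed_cons[Hl _] Hm.
  have [m1 [E1 E2 E3 E4 E5]] := compile_expr2_correct (out s) ok1 ok2 Hp Hm.
  have dd : d != d.+2 by rewrite neq_ltn ltnW.
  have [m2 [F1 F2 F3]] := exec_address m1 (out s) dd Ha.
  set k := size (compile_expr e1 d ++ _) in E1 F1 Hl *.
  exists (k + (K.+1 + 1)), (upd m2 (m2 (temp d.+2)) (m2 (temp d.+1))); split.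
  + rewrite /= !size_cat /= !size_cat size_nseq /= /k size_cat.
    by rewrite (size_compile_expr e1 0 d) (size_compile_expr e2 1 d.+1); lia.
  + rewrite !execD E1 F1 exec1 /= /current /= Hl.
    by congr Config; rewrite /= !size_cat /= !size_cat size_nseq /= /k size_cat; lia.
  + have dd' : temp d.+1 != temp d.+2 by rewrite temp_inj neq_ltn ltnSn.
    rewrite F2 (F3 _ dd') E2 E3 /=; apply: represents_set => //.
    exact: represents_frame F3.
  + move=> j jd; rewrite F2 /upd eq_sym cell_temp // F3 ?E5 //.
    by rewrite temp_inj; apply/eqP; lia.
- rewrite /= => /andP[ok1 ok2] /placed_cat[Hp1 Hp2] Hm.
  have [t1 [m1 [E1 E2 E3 E4]]] := IH1 _ _ _ _ ok1 Hp1 Hm.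
  have [t2 [m2 [F1 F2 F3 F4]]] := IH2 _ _ _ _ ok2 Hp2 E3.
  exists (t1 + t2), m2; split=> //; first exact: leq_add.
    by rewrite execD E2 F2 size_cat addnA.
  exact: agree_below_trans (leqnn d) E4 F4.
- rewrite [cmd_ok _]/= => /and4P[ok1 ok2 okc1 okc2].
  rewrite [compile _ _ _]/=; set pe := compile_expr e1 d ++ _.
  set p2 := compile c2 _ _; set l1 := (_ + _).+2; set p1 := compile c1 _ _.
  case/placed_cat => Hpe /placed_cons[Hj /placed_cat[Hp2 /placed_cons[Hj2 Hp1]]] Hm.
  have [m1 [E1 E2 E3 E4 E5]] := compile_expr2_correct (out s) ok1 ok2 Hpe Hm.
  have Ete : size (compile_expr e1 0 ++ compile_expr e2 0) = size pe.
    by rewrite /pe !size_cat (size_compile_expr e1 0 d) (size_compile_expr e2 0 d.+1).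
  have El1 : ((l + size pe).+1 + size p2).+1 = l1 by rewrite /l1; lia.
  rewrite El1 in Hp1.
  rewrite [time _ _]/= Ete [sem _ _ _]/=; case: ifP => hlt.
  + have [t1 [m2 [F1 F2 F3 F4]]] := IH1 _ _ _ _ okc1 Hp1 E4.
    exists (size pe + (1 + t1)), m2; split=> //; first lia.
      rewrite !execD E1 exec1 /= /current /= Hj E2 E3 hlt F2; congr Config.
      by rewrite -/p1 -El1 /pe !size_cat /= !size_cat /=; lia.
    exact: agree_below_trans (leqnn d) E5 F4.
  + have [t2 [m2 [F1 F2 F3 F4]]] := IH2 _ _ _ _ okc2 Hp2 E4.
    exists (size pe + (1 + (t2 + 1))), m2; split=> //; first lia.
      rewrite execD E1 execD exec1 /= /current /= Hj E2 E3 hlt execD F2 exec1 /= /current /= Hj2.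
      by congr Config; rewrite -El1 /pe !size_cat /= !size_cat /=; lia.
    exact: agree_below_trans (leqnn d) E5 F4.
- rewrite [cmd_ok _]/= => okc; rewrite [compile _ _ _]/=; set q := compile c _ _.
  move=> /placed_cons[H0 /placed_cons[H1 /placed_cons[H2 /placed_cons[H3 /placed_cons[H4
    /placed_cons[H5 /placed_cons[H6 /placed_cons[H7 /placed_cat[Hq /placed_cons[H8 _]]]]]]]]]].
  move=> Hm; rewrite [sem _ _ _]/=.
  have l8 : l.+4.+4 = l + 8 by lia.
  rewrite l8 in Hq H8.
  (* The invariant is stated at the loop test, with [k] the number of runs of the body still to
     come. *)
  have loop k m1 s1 : m1 (temp d) = k -> represents m1 s1 ->
    exists t m', [/\ t <= 3 + k * (5 + time c (size inp).+1),
      exec p t (Config l.+3 m1 (out s1)) =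
        Config (l + 8 + size q).+1 m' (out (iter k (sem inp c) s1)),
      represents m' (iter k (sem inp c) s1) & agree_below d m1 m'].
    elim: k m1 s1 => [|k IHk] m1 s1 mk Hm1.
      exists 3, (upd m1 (temp d.+1) 0); split=> //.
      - rewrite execS /step /current /= H3 execS /step /current /= H4 {1 2}/upd !temp_inj eqxx.
        by rewrite (ltn_eqF (ltnSn d)) mk exec1 /step /current /= H5.
      - exact: represents_upd_temp.
      - exact: agree_below_upd.
    set m2 := upd (upd (upd m1 (temp d.+1) 0) (temp d.+1) 1) (temp d) k.
    have Hm2 : represents m2 s1 by do 3!apply: represents_upd_temp.
    have [t1 [m3 [F1 F2 F3 F4]]] := IH _ _ _ _ okc Hq Hm2.
    have m3k : m3 (temp d) = k by rewrite F4 // /m2 /upd eqxx.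
    have [t2 [m4 [G1 G2 G3 G4]]] := IHk _ _ m3k F3.
    exists (4 + (t1 + (1 + t2))), m4; rewrite -iterSr in G2 G3; split=> //; first lia.
    - rewrite !execD.
      have -> : exec p 4 (Config l.+3 m1 (out s1)) = Config (l + 8) m2 (out s1).
        have dN : (d == d.+1) = false by rewrite ltn_eqF.
        have l6 : l + 6 = l.+4.+2 by lia.
        rewrite execS /step /current /= H3 execS /step /current /= H4.
        rewrite {1 2}/upd !temp_inj eqxx dN mk /= l6.
        rewrite execS /step /current /= H6 exec1 /step /current /= H7 l8.
        by rewrite /m2 /upd !temp_inj !eqxx dN mk subn1.
      by rewrite F2 exec1 /= /current /= H8 addn3 G2.
    - have A2 : agree_below d m1 m2 by do 3!apply: agree_below_upd => //.
      apply: agree_below_trans (leqnn d) _ G4.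
      exact: agree_below_trans (leqnSn d) A2 F4.
  set m0 := upd (upd (upd m (temp d) (size inp)) (temp d.+1) 1) (temp d) (size inp).+1.
  have mk : m0 (temp d) = (size inp).+1 by rewrite /m0 /upd eqxx.
  have Hm0 : represents m0 s by do 3!apply: represents_upd_temp.
  have [t [m' [G1 G2 G3 G4]]] := loop _ _ _ mk Hm0.
  exists (3 + t), m'; split=> //.
    rewrite execD.
    have -> : exec p 3 (Config l m (out s)) = Config l.+3 m0 (out s).
      have dN : (d == d.+1) = false by rewrite ltn_eqF.
      rewrite execS /step /current /= H0 execS /step /current /= H1 exec1 /step /current /= H2.
      by rewrite /m0 /upd !temp_inj !eqxx dN addn1.
    by rewrite G2; congr Config; rewrite /= size_cat /=; lia.
  have A2 : agree_below d m m0 by do 3!apply: agree_below_upd => //.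
  exact: agree_below_trans (leqnn d) A2 G4.
- rewrite /= => ok1 /placed_cat[Hp /placed_cons[Hl _]] Hm.
  have [m1 [E1 E2 E3 E4]] := compile_expr_correct (out s) ok1 Hp Hm.
  exists (size (compile_expr e d) + 1), m1; split=> //.
    by rewrite size_cat (size_compile_expr e d 0).
  by rewrite execD E1 exec1 /= /current /= Hl E2; congr Config; rewrite size_cat /=; lia.
Qed.
End Compiler.

Theorem compile_polytime (R : seq nat -> seq nat -> Prop) (c : cmd) (K : nat) :
  0 < K -> cmd_ok K c ->
  (forall inp, R inp (out (sem inp c (State (fun _ _ => 0) [::])))) ->
  polytime_solvable R.
Proof.
case: K => // K _ okc HR.
have [C [d HC]] := time_poly K.+1 c.
(* On a nonempty input [size inp + 1] is at most twice the input size, hence the factor [2 ^ d]; the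
   additive constant serves the empty input. *)
exists (compile K.+1 c 0 0), (C * 2 ^ d), d => inp.
have Hp : placed (compile K.+1 c 0 0) 0 (compile K.+1 c 0 0) by move=> i _.
have Hm : represents K.+1 (fun _ => 0) (State (fun _ _ => 0) [::]) by [].
have [t [m' [T1 T2 _ _]]] := compile_correct inp (ltn0Sn K) okc Hp Hm.
exists t; have -> : run (compile K.+1 c 0 0) inp t =
    exec inp (compile K.+1 c 0 0) t (Config 0 (fun _ => 0) [::]) by [].
rewrite T2; split; last exact: HR.
- apply: leq_trans T1 _; apply: leq_trans (HC _ (ltn0Sn _)) _.
  have : size inp <= input_size inp.
    rewrite /input_size; elim: inp {T2} => //= x s IH.
    by rewrite big_cons; apply: leq_ltn_trans IH _; rewrite addSn ltnS leq_addl.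
  move: (size inp) (input_size inp) => n k nk.
  rewrite -mulnA -mulnDr leq_mul2l; apply/orP; right.
  case: (posnP k) => [k0|kp].
    by move: nk; rewrite k0 leqn0 => /eqP ->; rewrite exp1n (leq_trans _ (leq_addl _ _)) // expn_gt0.
  apply: leq_trans (leq_addr _ _); rewrite -expnMn.
  by case: d {HC} => // d; rewrite leq_exp2r //; lia.
by rewrite /halted /current /= add0n nth_default.
Qed.

(** * Maximum matchings *)

Section Involutions.
Variable V : finType.
Implicit Types (m n : V -> V) (A C X Y : {set V}).

Definition unmatched m : {set V} := [set v | m v == v].

Definition switch C m n : V -> V := fun v => if v \in C then m v else n v.

Definition restrict X m : V -> V := fun v => if (v \in X) || (m v \in X) then v else m v.

Definition add_edge m (u v : V) : V -> V :=
  fun x => if x == u then v else if x == v then u else m x.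

Lemma involution_even A m : involutive m ->
  (forall x, x \in A -> m x \in A) -> (forall x, x \in A -> m x != x) -> ~~ odd #|A|.
Proof.
move=> mK; have [k] := ubnP #|A|; elim: k A => // k IH A ltk Acl Afix.
have [->|[x xA]] := set_0Vmem A; first by rewrite cards0.
have mxA := Acl x xA; have mxx := Afix x xA.
have mxA' : m x \in A :\ x by rewrite !inE mxx.
have cA := cardsD1 x A; have cA' := cardsD1 (m x) (A :\ x); rewrite xA mxA' in cA cA'.
rewrite cA cA' /= negbK; apply: IH => [|y|y]; first lia.
  rewrite !inE => /and3P[ymx yx yA]; rewrite Acl // andbT (inj_eq (inv_inj mK)) yx /=.
  by apply: contraNneq ymx => <-; rewrite mK.
by rewrite !inE => /and3P[_ _ yA]; apply: Afix.
Qed.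

Lemma odd_unmatched m : involutive m -> odd #|unmatched m| = odd #|V|.
Proof.
move=> mK; rewrite -(cardsC (unmatched m)) oddD.
rewrite (negPf (@involution_even (~: unmatched m) m mK _ _)) ?addbF // => x; rewrite !inE //.
by rewrite mK eq_sym.
Qed.

Definition orb m n t : {set V} := [set v | fconnect (m \o n) t v].

Section Orbit.
Variables (m n : V -> V) (t : V).
Hypotheses (mK : involutive m) (nK : involutive n).
Let f := m \o n.

Let f_inj : injective f.
Proof. by move=> x y /(inv_inj mK)/(inv_inj nK). Qed.

Let iter_m i : m t = t -> iter i f (m (iter i f t)) = t.
Proof.
move=> mt; elim: i => [|i IH]; first exact: mt.
rewrite iterSr [iter i.+1 f t]iterS.
have -> y : f (m (f y)) = m y by rewrite /f /= mK nK.
exact: IH.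
Qed.

Let iter_n i : n t = t -> iter i f (n (iter i f t)) = t.
Proof.
move=> nt; elim: i => [|i IH]; first exact: nt.
rewrite iterSr [iter i.+1 f t]iterS.
have -> y : f (n (f y)) = n y by rewrite /f /= nK mK.
exact: IH.
Qed.

(** Bounds the length of the walk by the number of vertices, which for ['I_N] is the number of
    rounds of one [Rep]. *)
Lemma orb_iter v :
  (v \in orb m n t) = [exists i : 'I_#|V|, v == iter i (m \o n) t].
Proof.
rewrite inE; apply/idP/existsP => [tv|[i /eqP ->]]; last exact: fconnect_iter.
have := findex_max tv => lti; have := leq_trans lti (max_card _) => lti'.
by exists (Ordinal lti'); rewrite /= iter_findex.
Qed.

Lemma orb_refl : t \in orb m n t.
Proof. by rewrite inE connect0. Qed.

(** An involution conjugates [m \o n] to its inverse; if it also fixes [t], it reflects the orbit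
    onto itself. Without such an end, the orbit may be just one half of an alternating cycle. *)
Lemma orb_closed : m t = t \/ n t = t ->
  forall x, x \in orb m n t -> (m x \in orb m n t) && (n x \in orb m n t).
Proof.
have back i y : iter i f y = t -> y \in orb m n t.
  by move=> <-; rewrite inE fconnect_sym // fconnect_iter.
case=> [mt|nt] x; rewrite {1}inE => /iter_findex; rewrite -/f; move: (findex _ _ _) => i <-.
  rewrite (back i) ?iter_m //=; apply: (back i.+1).
  by have := iter_m i.+1 mt; rewrite [X in m X]/= {2}/f /= mK.
rewrite [n _ \in _](back i) ?iter_n // andbT.
have -> : m (iter i f t) = f (n (iter i f t)) by rewrite /f /= nK.
case: i => [|i]; first by rewrite /= nt inE fconnect1.
by apply: (back i); rewrite -iterSr iter_n.
Qed.

(* The orbit of [t] under [m \o n] is the alternating component of [t], a path with two ends. *)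
Lemma orb_events : m t = t -> n t != t ->
  exists2 z, z != t &
    (unmatched m :&: orb m n t = [set t; z] /\ unmatched n :&: orb m n t = set0) \/
    (unmatched m :&: orb m n t = [set t] /\ unmatched n :&: orb m n t = [set z]).
Proof.
move=> mt nt; set p := order f t.
have p0 : 0 < p by exact: order_gt0.
have xp : iter p f t = t by exact: iter_order.
have inj i j : i < p -> j < p -> (iter i f t == iter j f t) = (i == j).
  move=> ip jp; apply/eqP/eqP => [E|-> //].
  by rewrite -(findex_iter ip) E findex_iter.
have mx i : i <= p -> m (iter i f t) = iter (p - i) f t.
  have iter_inj : injective (iter i f) by elim: (i) => // j IH x y /f_inj/IH.
  move=> ip; apply: iter_inj.
  by rewrite iter_m // -iterD subnKC // xp.
have nx i : i < p -> n (iter i f t) = iter (p - i.+1) f t.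
  by move=> ip; rewrite -mx // /f /= mK.
have mfix i : i < p -> (m (iter i f t) == iter i f t) = (i == 0) || (i + i == p).
  move=> ip; rewrite mx; last lia.
  case: i ip => [|i] ip; first by rewrite subn0 xp /= eqxx.
  by rewrite inj; lia.
have nfix i : i < p -> (n (iter i f t) == iter i f t) = (i + i + 1 == p).
  by move=> ip; rewrite nx // inj; lia.
have inO v : reflect (exists2 i, i < p & v = iter i f t) (v \in orb m n t).
  rewrite inE; apply: (iffP idP) => [tv|[i _ ->]]; last exact: fconnect_iter.
  by exists (findex f t v); [exact: findex_max | rewrite iter_findex].
(* [m] sends index [i] to [p - i] and [n] sends it to [p - i - 1], modulo [p]. The other end of the
   path is thus the index [p./2], fixed by [n] for odd [p] and by [m] for even [p]. *)
have ph := odd_double_half p; set h := p./2 in ph.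
have hp : h < p by lia.
exists (iter h f t).
  rewrite -[X in _ != X]/(iter 0 f t) inj //; apply/eqP => h0.
  have := nfix 0 p0; rewrite /= (negPf nt) => /esym/eqP; lia.
case: (boolP (odd p)) ph => op ph; [right|left]; split; apply/setP => v.
- rewrite in_setI [v \in unmatched _]inE in_set1; apply/andP/eqP => [[E /inO[i ip vi]]|->].
    by subst v; move: E; rewrite mfix //; case/orP => /eqP; [move->|lia].
  by rewrite mt eqxx orb_refl.
- rewrite in_setI [v \in unmatched _]inE in_set1; apply/andP/eqP => [[E /inO[i ip vi]]|->].
    by subst v; move: E; rewrite nfix // => /eqP ?; congr (iter _ f t); lia.
  by rewrite nfix //; split; [lia | apply/inO; exists h].
- rewrite in_setI [v \in unmatched _]inE in_set2; apply/andP/orP => [[E /inO[i ip vi]]|].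
    subst v; move: E; rewrite mfix //; case/orP => /eqP E; [by left; rewrite E|right].
    by apply/eqP; congr (iter _ f t); lia.
  case=> /eqP->; first by rewrite mt eqxx orb_refl.
  by rewrite mfix //; split; [lia | apply/inO; exists h].
- rewrite in_setI [v \in unmatched _]inE in_set0; apply/andP => -[E /inO[i ip vi]].
  by subst v; move: E; rewrite nfix // => /eqP; lia.
Qed.

End Orbit.

(** Makes closure under switching [m] into [n] along a path also serve for the opposite switch. *)
Lemma orb_swap m n t : involutive m -> involutive n -> m t = t \/ n t = t ->
  orb n m t = orb m n t.
Proof.
have sub m1 n1 : involutive m1 -> involutive n1 -> m1 t = t \/ n1 t = t ->
    forall v, v \in orb n1 m1 t -> v \in orb m1 n1 t.
  move=> mK nK fixt v; rewrite inE => /iter_findex <-.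
  elim: (findex _ _ _) => [|i IH]; first exact: orb_refl.
  have cl := orb_closed mK nK fixt.
  by rewrite /=; have /andP[+ _] := cl _ IH => /cl/andP[].
move=> mK nK fixt; apply/setP => v; apply/idP/idP; apply: sub => //.
by case: fixt; [right|left].
Qed.

Lemma card_unmatched_switch C m n :
  #|unmatched (switch C m n)| + #|unmatched n :&: C| = #|unmatched n| + #|unmatched m :&: C|.
Proof.
rewrite -(cardsID C (unmatched (switch C m n))) -(cardsID C (unmatched n)).
have -> : unmatched (switch C m n) :&: C = unmatched m :&: C.
  by apply/setP => v; rewrite !inE /switch; case: (v \in C); rewrite ?andbF.
have -> : unmatched (switch C m n) :\: C = unmatched n :\: C.
  by apply/setP => v; rewrite !inE /switch; case: (v \in C).
lia.
Qed.

Lemma switch_involutive C m n : involutive m -> involutive n ->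
  (forall x, x \in C -> (m x \in C) && (n x \in C)) -> involutive (switch C m n).
Proof.
move=> mK nK cl v; rewrite /switch; case: (boolP (v \in C)) => vC.
  by have /andP[-> _] := cl _ vC.
by case: (boolP (n v \in C)) => [/cl/andP[_]|_]; rewrite nK // (negPf vC).
Qed.

Lemma restrict_involutive X m : involutive m -> involutive (restrict X m).
Proof.
move=> mK v; rewrite /restrict; case: (boolP (v \in X)) => [vX|vX] /=; first by rewrite vX.
by case: (boolP (m v \in X)) => mvX; rewrite ?mK (negPf vX) ?mvX // (negPf mvX).
Qed.

(** Every deleted edge has an end in [Y] and frees two vertices. [Y] can be smaller than [X], for
    instance when [X] holds both ends of an edge. *)
Lemma card_unmatched_restrict X Y m : involutive m ->
  (forall x, x \in X -> [|| m x == x, x \in Y | m x \in Y]) ->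
  #|unmatched (restrict X m)| <= #|unmatched m| + 2 * #|Y|.
Proof.
move=> mK XY; have -> : 2 * #|Y| = #|Y| + #|m @: Y|.
  by rewrite card_imset ?mul2n ?addnn //; exact: inv_inj.
have sub : unmatched (restrict X m) \subset unmatched m :|: (Y :|: m @: Y).
  have inY v : m v \in Y -> v \in m @: Y by move=> H; apply/imsetP; exists (m v).
  apply/subsetP => v; rewrite !inE /restrict; case: ifP => [vX _|_ ->//].
  case/orP: vX => /XY; first by case/or3P => [->|->|/inY->]; rewrite ?orbT.
  rewrite mK eq_sym; case/or3P => [->|/inY->|->]; rewrite ?orbT //.
apply: leq_trans (subset_leq_card sub) _; rewrite -cardsUI.
by have := cardsUI Y (m @: Y); have := cardsUI (unmatched m) (Y :|: m @: Y); lia.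
Qed.

Lemma add_edge_involutive m u v : involutive m -> m u = u -> m v = v ->
  involutive (add_edge m u v).
Proof.
move=> mK mu mv x; rewrite /add_edge.
have [->|xu] := eqVneq x u; first by rewrite eqxx; case: eqP.
have [->|xv] := eqVneq x v; first by rewrite eqxx.
have -> : (m x == u) = false by rewrite -mu (inj_eq (inv_inj mK)) (negPf xu).
have -> : (m x == v) = false by rewrite -mv (inj_eq (inv_inj mK)) (negPf xv).
exact: mK.
Qed.

Lemma card_unmatched_add_edge m u v : u != v -> m u = u -> m v = v ->
  #|unmatched (add_edge m u v)| + 2 = #|unmatched m|.
Proof.
move=> uv mu mv; have -> : unmatched (add_edge m u v) = unmatched m :\ u :\ v.
  apply/setP => x; rewrite !inE /add_edge.
  have [->|xu] := eqVneq x u; first by rewrite andbF eq_sym (negPf uv).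
  by have [->|xv] := eqVneq x v; first by rewrite (negPf uv).
have := cardsD1 v (unmatched m :\ u); have := cardsD1 u (unmatched m).
by rewrite !inE mu mv !eqxx eq_sym uv /=; lia.
Qed.

End Involutions.

(** * Maximality from a family of matchings that absorbs exchanges *)

Section Matching.
Variables (V : finType) (e : rel V).
Hypotheses (e_sym : symmetric e) (e_irr : irreflexive e).
Implicit Types (m n : {ffun V -> V}) (X Y : {set V}).

Definition matching (m : V -> V) : Prop :=
  involutive m /\ forall v, m v != v -> e v (m v).

Variable K : {set {ffun V -> V}}.

(* The bound 4 accounts for two vertices of a component of [D] and their mates in [A]. *)
Definition absorbed (n : V -> V) : Prop :=
  forall X, #|X| <= 4 -> exists2 m, m \in K &
    (forall x, x \in X -> m x = x) /\ #|unmatched m| <= #|unmatched (restrict X n)|.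

Hypothesis K_matching : forall m, m \in K -> matching m.
Hypothesis K_self : forall m, m \in K -> absorbed m.
Hypothesis K_add : forall m u v, m \in K -> e u v -> m u = u -> m v = v ->
  absorbed (add_edge m u v).
Hypothesis K_switch : forall m n t, m \in K -> n \in K -> m t = t \/ n t = t ->
  absorbed (switch (orb m n t) m n).

Variable m0 : {ffun V -> V}.
Hypothesis m0K : m0 \in K.
Hypothesis m0_min : forall m, m \in K -> #|unmatched m0| <= #|unmatched m|.

Let f0 := #|unmatched m0|.

Let K_inv m : m \in K -> involutive m.
Proof. by move=> /K_matching[]. Qed.

Let known (n : V -> V) X Y : absorbed n -> involutive n -> #|X| <= 4 ->
  (forall x, x \in X -> [|| n x == x, x \in Y | n x \in Y]) ->
  exists2 m, m \in K & (forall x, x \in X -> m x = x) /\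
    #|unmatched m| <= #|unmatched n| + 2 * #|Y|.
Proof.
move=> nA nK X4 XY; have [m mK [mX le]] := nA X X4.
by exists m => //; split=> //; apply: leq_trans le _; apply: card_unmatched_restrict.
Qed.

Let known_fix (n : V -> V) X : absorbed n -> involutive n -> #|X| <= 4 ->
  (forall x, x \in X -> n x = x) ->
  exists2 m, m \in K & (forall x, x \in X -> m x = x) /\ #|unmatched m| <= #|unmatched n|.
Proof.
move=> nA nK X4 XY; have [|m mK [mX le]] := @known n X set0 nA nK X4.
  by move=> x /XY ->; rewrite eqxx.
by exists m => //; split=> //; rewrite cards0 muln0 addn0 in le.
Qed.

Let D : {set V} := [set x | [exists m in K, (m x == x) && (#|unmatched m| <= f0)]].
Let A : {set V} := [set a | (a \notin D) && [exists y in D, e a y]].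

Let inD m x : m \in K -> m x = x -> #|unmatched m| <= f0 -> x \in D.
Proof. by move=> mK mx le; rewrite inE; apply/existsP; exists m; rewrite mK mx eqxx. Qed.

Let D_wit x : x \in D -> exists2 m, m \in K & m x = x /\ #|unmatched m| <= f0.
Proof. by rewrite inE => /existsP[m /and3P[mK /eqP mx le]]; exists m. Qed.

Let parity (n : V -> V) : involutive n -> odd #|unmatched n| = odd f0.
Proof. by move=> nK; rewrite /f0 !odd_unmatched //; exact: K_inv. Qed.

(** The numbers of unmatched vertices of all involutions have the same parity, so exceeding [f0]
    means exceeding it by at least 2. *)
Let notD m a : m \in K -> m a = a -> a \notin D -> f0 + 2 <= #|unmatched m|.
Proof.
move=> mK ma aD; case: (leqP #|unmatched m| f0) => [le|]; last first.
  by move: (parity (K_inv mK)); clear; lia.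
by rewrite (inD mK ma le) in aD.
Qed.

Let notD_absorbed (n : V -> V) a : absorbed n -> involutive n -> n a = a -> a \notin D ->
  f0 + 2 <= #|unmatched n|.
Proof.
move=> nA nK na aD; have [||m mK [mX le]] := @known_fix n [set a] nA nK; rewrite ?cards1 //.
  by move=> x /set1P->.
by apply: leq_trans le; apply: notD aD => //; apply: mX; rewrite inE.
Qed.

Let switch_inv m n t : m \in K -> n \in K -> m t = t \/ n t = t ->
  involutive (switch (orb m n t) m n) /\ involutive (switch (orb m n t) n m).
Proof.
move=> mK nK h; have cl := orb_closed (K_inv mK) (K_inv nK) h.
split; apply: switch_involutive => //; try exact: K_inv.
by move=> x /cl; rewrite andbC.
Qed.

Let K_switch' m n t : m \in K -> n \in K -> m t = t \/ n t = t ->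
  absorbed (switch (orb m n t) n m).
Proof.
move=> mK nK h; rewrite -orb_swap //; try exact: K_inv.
by apply: K_switch => //; case: h; [right|left].
Qed.

(* An alternating path from [a] either frees [a] or [b] in an optimal matching, or ends
   in [b]; in the last case both can be freed together with the neighbour [y] of [a],
   and the edge [a y] restores optimality. *)
Let missing_pair m a b : m \in K -> m a = a -> m b = b -> a \in A -> b \notin D -> a != b ->
  f0 + 4 <= #|unmatched m|.
Proof.
move=> mK ma mb; rewrite inE => /andP[aD /existsP[y /andP[yD eay]]] bD ab.
have by_ : b != y by apply: contraNneq bD => ->.
have [M MK [My Mle]] := D_wit yD.
have M0 := m0_min MK; rewrite -/f0 in M0.
have Ma : M a != a by apply/eqP => /(inD MK)/(_ Mle) aD'; rewrite aD' in aD.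
rewrite leqNgt; apply/negP => lt4; have le2 : #|unmatched m| <= f0 + 2.
  by move: (parity (K_inv mK)) lt4; clear; lia.
have ta : m a = a \/ M a = a by left.
have [z za ev] := orb_events (K_inv mK) (K_inv MK) ma Ma.
have [swi swi'] := switch_inv mK MK ta.
have sw := K_switch mK MK ta; have sw' := K_switch' mK MK ta.
have c1 := card_unmatched_switch (orb m M a) m M.
have c2 := card_unmatched_switch (orb m M a) M m.
case: ev => [[Em EM]|[Em EM]]; rewrite Em EM ?cards2 ?cards1 ?cards0 ?[a == z]eq_sym ?za in c1 c2.
- have [zb|zb] := eqVneq z b.
    subst z; have inC x : x \in [set a; b] -> m x = x /\ x \in orb m M a.
      by rewrite -Em !inE => /andP[/eqP].
    have [_ aC] : m a = a /\ a \in orb m M a by apply: inC; rewrite !inE eqxx.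
    have [_ bC] : m b = b /\ b \in orb m M a by apply: inC; rewrite !inE eqxx orbT.
    have yC : y \notin orb m M a.
      apply/negP => yC; have : y \in unmatched M :&: orb m M a by rewrite in_setI yC inE My eqxx.
      by rewrite EM inE.
    have [||n nK [nX nle]] := @known_fix _ ([set a; b] :|: [set y]) sw swi.
    + by rewrite (leq_trans (leq_card_setU _ _)) // cards2 cards1; case: (_ != _).
    + by move=> x; rewrite !inE -orbA /switch => /or3P[] /eqP->; rewrite ?aC ?bC ?(negPf yC).
    have [na nb ny] : [/\ n a = a, n b = b & n y = y].
      by split; apply: nX; rewrite !inE eqxx ?orbT.
    have ay : a != y by apply: contraNneq aD => ->.
    have := card_unmatched_add_edge ay na ny.
    have := notD_absorbed (K_add nK eay na ny) (add_edge_involutive (K_inv nK) na ny) _ bD.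
    rewrite /add_edge eq_sym (negPf ab) (negPf by_) => /(_ nb).
    by rewrite -/(add_edge n a y); move: nle c1 M0 Mle; clear; lia.
  have bC : b \notin orb m M a.
    apply/negP => bC; have : b \in unmatched m :&: orb m M a by rewrite in_setI bC inE mb eqxx.
    by rewrite Em !inE eq_sym (negPf ab) eq_sym (negPf zb).
  have := notD_absorbed sw' swi' _ bD; rewrite {1}/switch (negPf bC) => /(_ mb).
  by move: c2 le2; clear; lia.
- have aC : a \in orb m M a := orb_refl _ _ _.
  have := notD_absorbed sw swi _ aD; rewrite {1}/switch aC => /(_ ma).
  by move: c1 Mle; clear; lia.
Qed.

Let r : rel V := [rel x y | [&& x \in D, y \in D & e x y]].

Let r_sym : connect_sym r.
Proof. by apply: sym_connect_sym => x y; rewrite /r /= e_sym andbCA. Qed.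

Let connect_D x y : connect r x y -> x \in D -> y \in D.
Proof.
case/connectP => p; elim: p x => [|z p IH] x /=; first by move=> _ ->.
by case/andP => /and3P[_ zD _] /IH H E _; apply: H.
Qed.

(* Gallai's lemma in the graph without [X]: walking from [u] to [v] in [D], exchange with a
   matching that avoids the next vertex [t] until two unmatched vertices are adjacent. *)
Let missing_component X u v m : X \subset A -> #|X| <= 2 -> u \in D -> v \in D -> u != v ->
  connect r u v -> m \in K -> (forall x, x \in X -> m x = x) -> m u = u -> m v = v ->
  f0 + 2 * #|X| < #|unmatched m|.
Proof.
move=> XA X2.
have XD x : x \in X -> x \notin D by move/(subsetP XA); rewrite inE => /andP[].
(* The three sizes of [X] use the minimality of [m0], parity, and [missing_pair]. *)
have LB n : n \in K -> (forall x, x \in X -> n x = x) -> f0 + 2 * #|X| <= #|unmatched n|.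
  move=> nK nX; case E : #|X| X2 => [|[|[|//]]] _; first by rewrite muln0 addn0 m0_min.
    have /cards1P[a Xa] : #|X| == 1 by rewrite E.
    have aX : a \in X by rewrite Xa inE.
    by apply: notD (XD a aX) => //; apply: nX.
  have /cards2P[a [b [ab Xab]]] : #|X| == 2 by rewrite E.
  have aX : a \in X by rewrite Xab !inE eqxx.
  have bX : b \in X by rewrite Xab !inE eqxx orbT.
  apply: (missing_pair nK (nX a aX) (nX b bX)) => //; [exact: (subsetP XA) | exact: XD].
have LBa (n : V -> V) : absorbed n -> involutive n -> (forall x, x \in X -> n x = x) ->
    f0 + 2 * #|X| <= #|unmatched n|.
  move=> nA nK nX; have [|p pK [pX ple]] := @known_fix n X nA nK _ nX; first exact: leq_trans X2 _.
  exact: leq_trans (LB p pK pX) ple.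
have cX3 a : #|X :|: [set a]| <= 4.
  by rewrite (leq_trans (leq_card_setU _ _)) // cards1 addn1; apply: leq_ltn_trans X2 _.
have cX4 a b : #|X :|: [set a; b]| <= 4.
  by rewrite (leq_trans (leq_card_setU _ _)) // cards2 -[4]/(2 + 2) leq_add //; case: (_ != _).
have adj a b n : a \in D -> b \in D -> e a b -> n \in K -> (forall x, x \in X -> n x = x) ->
    n a = a -> n b = b -> f0 + 2 * #|X| < #|unmatched n|.
  move=> aD bD eab nK nX na nb; have ab : a != b by apply/eqP => E; rewrite E e_irr in eab.
  have := card_unmatched_add_edge ab na nb.
  suff : f0 + 2 * #|X| <= #|unmatched (add_edge n a b)| by clear; lia.
  apply: LBa; [exact: K_add | by apply: add_edge_involutive => //; exact: K_inv | move=> x xX].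
  have xD := XD x xX; rewrite /add_edge.
  have [xa|_] := eqVneq x a; first by rewrite xa aD in xD.
  have [xb|_] := eqVneq x b; first by rewrite xb bD in xD.
  exact: nX.
move=> uD vD uv /connectP[p]; elim: p u uD uv m => [|t p IH] u uD uv n /=.
  by move=> _ E; rewrite E eqxx in uv.
move=> /andP[/and3P[_ tD eut] pth] vlast nK nX nu nv.
have [tv|tv] := eqVneq t v; first by subst t; exact: (adj u v n).
rewrite ltnNge; apply/negP => le.
(* Once [t] is unmatched together with [u] or [v], the edge from [u] to [t] or the shorter walk from
   [t] to [v] gives the contradiction. *)
have done1 q : q \in K -> (forall x, x \in X -> q x = x) -> q t = t -> q u = u \/ q v = v ->
    #|unmatched q| <= f0 + 2 * #|X| -> False.
  move=> qK qX qt [qu|qv] qle; first by have := adj u t q uD tD eut qK qX qu qt; rewrite ltnNge qle.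
  by have := IH t tD tv q pth vlast qK qX qt qv; rewrite ltnNge qle.
have done2 (q : V -> V) : absorbed q -> involutive q -> (forall x, x \in X -> q x = x) ->
    q t = t -> q u = u \/ q v = v -> #|unmatched q| <= f0 + 2 * #|X| -> False.
  move=> qA qK qX qt quv qle.
  have [w [qw wuv]] : exists w, q w = w /\ (w = u \/ w = v).
    by case: quv => ?; [exists u|exists v]; split=> //; [left|right].
  have [x|s sK [sX sle]] := @known_fix q (X :|: [set t; w]) qA qK (cX4 t w).
    by rewrite !inE => /or3P[/qX//|/eqP->|/eqP->].
  apply: (done1 s sK); last exact: leq_trans sle qle.
  - by move=> x xX; apply: sX; rewrite inE xX.
  - by apply: sX; rewrite !inE eqxx orbT.
  - by case: wuv => E; [left|right]; rewrite -E; apply: sX; rewrite !inE eqxx !orbT.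
have [nt|nt] := eqVneq (n t) t; first by apply: (done1 n) => //; left.
have [M0 M0K [M0t M0le]] := D_wit tD.
have [|M MK [MX Mle]] := @known M0 (X :|: [set t]) X (K_self M0K) (K_inv M0K) (cX3 t).
  by move=> x; rewrite !inE => /orP[->|/eqP->]; rewrite ?orbT // M0t eqxx.
have {}Mle : #|unmatched M| <= f0 + 2 * #|X|.
  by apply: leq_trans Mle _; rewrite leq_add2r.
have Mt : M t = t by apply: MX; rewrite !inE eqxx orbT.
have {}MX x : x \in X -> M x = x by move=> xX; apply: MX; rewrite inE xX.
have ht : M t = t \/ n t = t by left.
have [z zt ev] := orb_events (K_inv MK) (K_inv nK) Mt nt.
have [swi swi'] := switch_inv MK nK ht.
have sw := K_switch MK nK ht; have sw' := K_switch' MK nK ht.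
have c1 := card_unmatched_switch (orb M n t) M n.
have c2 := card_unmatched_switch (orb M n t) n M.
(* If both ends of the path are unmatched in [M], switching [M] along it beats the bound for [X].
   Otherwise switching [n] frees [t] and matches only [z], so [u] or [v] stays unmatched. *)
case: ev => [[EM En]|[EM En]]; rewrite EM En ?cards2 ?cards1 ?cards0 ?[t == z]eq_sym ?zt in c1 c2.
- have := LBa _ sw' swi'; suff H : forall x, x \in X -> switch (orb M n t) n M x = x.
    by move/(_ H); move: c2 Mle; clear; lia.
  by move=> x xX; rewrite /switch; case: ifP => _; [apply: nX|apply: MX].
- apply: (done2 _ sw swi) => [x xX|||].
  + by rewrite /switch; case: ifP => _; [apply: MX|apply: nX].
  + by rewrite /switch orb_refl.
  + have outC w : n w = w -> w != z -> switch (orb M n t) M n w = w.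
      move=> nw wz; rewrite /switch ifN //; apply/negP => wC.
      have : w \in unmatched n :&: orb M n t by rewrite in_setI wC inE nw eqxx.
      by rewrite En inE (negPf wz).
    have [uz|uz] := eqVneq u z; last by left; apply: outC.
    by right; apply: outC => //; rewrite -uz eq_sym.
  + by move: c1 le; clear; lia.
Qed.

Let exits (m : V -> V) : {set V} := [set x in D | (m x == x) || (m x \in A)].

Let in_exits (m : V -> V) x : (x \in exits m) = (x \in D) && ((m x == x) || (m x \in A)).
Proof. by rewrite in_set. Qed.

(** Deleting the edges of [m0] from [u] and [v] into [A] frees [u], [v] and the set [X] of their
    mates in [A], at a cost of at most [2 * #|X|]. If [u] and [v] differed, [missing_component]
    would forbid this. *)
Let exits_m0_uniq u v : u \in exits m0 -> v \in exits m0 -> connect r u v -> u = v.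
Proof.
rewrite !in_exits => /andP[uD uE] /andP[vD vE] uv; apply/eqP/negPn/negP => nuv.
set X := [set x in [set m0 u; m0 v] | x \in A].
have XA : X \subset A by apply/subsetP => x; rewrite inE => /andP[].
have X2 : #|X| <= 2.
  apply: leq_trans (subset_leq_card (_ : X \subset [set m0 u; m0 v])) _.
    by apply/subsetP => x; rewrite inE => /andP[].
  by rewrite cards2; case: (_ != _).
have [||m mK [mX mle]] := @known m0 (X :|: [set u; v]) X (K_self m0K) (K_inv m0K).
- by rewrite (leq_trans (leq_card_setU _ _)) // cards2 -[4]/(2 + 2) leq_add //; case: (_ != _).
- move=> x; rewrite in_setU in_set2 => /or3P[->|/eqP->|/eqP->]; rewrite ?orbT //.
    by case/orP: uE => [->//|uA]; rewrite [m0 u \in X]in_set in_set2 eqxx uA !orbT.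
  by case/orP: vE => [->//|vA]; rewrite [m0 v \in X]in_set in_set2 eqxx vA !orbT.
suff : f0 + 2 * #|X| < #|unmatched m| by rewrite ltnNge mle.
by apply: (missing_component XA X2 uD vD nuv uv mK) => [x xX||];
  apply: mX; rewrite in_setU in_set2 ?xX ?eqxx ?orbT.
Qed.

(** The mate of a vertex of [D] that is no exit stays in its component [C]. As [x] is the only exit
    of [m0] in [C], the rest of [C] is perfectly matched and [C] is odd; without an exit of [m] in
    [C] it would be even. *)
Let exits_other m x : matching m -> x \in exits m0 ->
  exists2 y, y \in exits m & connect r x y.
Proof.
move=> [mK mE] xE; have xD : x \in D by move: xE; rewrite in_exits => /andP[].
case: (boolP [exists y in exits m, connect r x y]) => [/exists_inP//|/exists_inPn H].
exfalso.
set C := [set y | connect r x y].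
have CD y : y \in C -> y \in D by rewrite inE => /connect_D; apply.
have step (n : V -> V) y : matching n -> y \in C -> y \notin exits n -> n y != y /\ n y \in C.
  move=> [_ nE] yC; have yD := CD _ yC; rewrite in_exits yD /= negb_or => /andP[ny nyA].
  have ey := nE _ ny; split=> //; have nyD : n y \in D.
    move: nyA; rewrite inE negb_and negbK => /orP[//|/negP[]].
    by apply/existsP; exists y; rewrite yD e_sym.
  move: yC; rewrite !inE => /connect_trans; apply; apply: connect1.
  by rewrite /r /= yD nyD.
have evC : ~~ odd #|C|.
  have nE y : y \in C -> y \notin exits m.
    by rewrite inE => xy; apply/negP => /H; rewrite xy.
  by apply: (involution_even mK) => y yC; have [] := step m y (conj mK mE) yC (nE y yC).
have : ~~ odd #|C :\ x|.
  have nE y : y \in C :\ x -> y \in C /\ y \notin exits m0.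
    rewrite in_setD1 => /andP[yx yC]; split=> //; apply: contraNN yx => yE.
    by apply/eqP/esym/exits_m0_uniq => //; move: yC; rewrite inE.
  apply: (involution_even (K_inv m0K)) => y yC; have [yC' yE] := nE y yC;
    have [ny nyC] := step m0 y (K_matching m0K) yC' yE => //.
  (* The mate of [y] is not [x]: as an exit, [x] is unmatched or has its mate in [A], which is
     disjoint from [D]. *)
  rewrite in_setD1 nyC andbT; apply: contraNneq yE => Ey.
  have xC' : m0 x = y by rewrite -Ey (K_inv m0K).
  move: xE; rewrite in_exits xC' => /andP[_ /orP[/eqP yx|yA]].
    by rewrite in_setD1 yx eqxx in yC.
  by have := CD _ yC'; move: yA; rewrite inE => /andP[/negPf->].
by have := cardsD1 x C; rewrite {2}/C inE connect0 => cC; rewrite cC /= negbK in evC; rewrite evC.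
Qed.

Theorem absorbing_family_maximum m : matching m -> f0 <= #|unmatched m|.
Proof.
move=> mM; have m0I := K_inv m0K.
have unD x : x \in unmatched m0 -> x \in D.
  by rewrite inE => /eqP E; apply: (inD m0K E).
(* Otherwise deleting the single edge at [a] would free two vertices outside [D] with at most
   [f0 + 2] unmatched, against [missing_pair]. *)
have AD a : a \in A -> m0 a \in D.
  move=> aA; apply/negPn/negP => naD.
  have aD : a \notin D by move: aA; rewrite inE => /andP[].
  have am : a != m0 a.
    by rewrite eq_sym; apply: contraNneq aD => E; apply: unD; rewrite inE E.
  have [||p pK [pX ple]] := @known m0 [set a; m0 a] [set a] (K_self m0K) m0I.
  - by rewrite cards2; case: (_ != _).
  - by move=> x; rewrite !inE => /orP[]/eqP->; rewrite ?eqxx ?orbT // m0I eqxx !orbT.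
  have := @missing_pair p a (m0 a) pK (pX _ _) (pX _ _) aA naD am.
  by rewrite !inE !eqxx orbT cards1 in ple * => /(_ isT isT); rewrite -/f0 in ple; move: ple; clear; lia.
have lower : f0 + #|A| <= #|exits m0|.
  rewrite -(card_imset A (inv_inj m0I)) /f0 -cardsUI.
  have -> : unmatched m0 :&: m0 @: A = set0.
    apply/setP => x; rewrite in_setI in_set0; apply/andP => -[xU /imsetP[a aA xa]].
    have aD : a \notin D by move: aA; rewrite inE => /andP[].
    move: xU; rewrite inE xa m0I => /eqP E; have := AD a aA.
    by rewrite -E (negPf aD).
  rewrite cards0 addn0; apply: subset_leq_card; apply/subsetP => x.
  rewrite in_setU => /orP[xU|/imsetP[a aA ->]].
    by rewrite in_exits unD //=; move: xU; rewrite inE => ->.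
  by rewrite in_exits AD //= m0I aA orbT.
have upper : #|exits m| <= #|unmatched m| + #|A|.
  have [mI _] := mM; rewrite -(card_imset A (inv_inj mI)).
  apply: leq_trans (leq_card_setU _ _); apply: subset_leq_card; apply/subsetP => x.
  rewrite in_exits => /andP[_ /orP[E|mA]]; rewrite in_setU; first by rewrite inE E.
  by apply/orP; right; apply/imsetP; exists (m x).
suff : #|exits m0| <= #|exits m| by move: lower upper; clear; lia.
(* Exits are compared through the roots of their components: each component has at most one exit of
   [m0], and at least one of [m] whenever it has one of [m0]. *)
have <- : #|root r @: exits m0| = #|exits m0|.
  apply: card_in_imset => u v uE vE /eqP; rewrite root_connect //.
  exact: exits_m0_uniq.
apply: leq_trans (leq_imset_card (root r) _); apply: subset_leq_card.
apply/subsetP => _ /imsetP[x xE ->]; have [y yE xy] := exits_other mM xE.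
by apply/imsetP; exists y => //; apply/eqP; rewrite root_connect.
Qed.

End Matching.

(** * Reasoning about programs *)

Fixpoint mods (c : cmd) : seq nat :=
  match c with
  | Skip | Write _ => [::]
  | Store a _ _ => [:: a]
  | Seq c1 c2 | If _ _ c1 c2 => mods c1 ++ mods c2
  | Rep c => mods c
  end.

Fixpoint silent (c : cmd) : bool :=
  match c with
  | Skip | Store _ _ _ => true
  | Write _ => false
  | Seq c1 c2 | If _ _ c1 c2 => silent c1 && silent c2
  | Rep c => silent c
  end.

Definition Var (a : nat) : expr := Get a (Const 0).
Definition Assign (a : nat) (e : expr) : cmd := Store a (Const 0) e.
Definition LenS : expr := Plus Len (Const 1).
(** With truncated subtraction this is the absolute difference; comparing it with 1 turns the only
    test, [<], into a test for equality. *)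
Definition Dist (e1 e2 : expr) : expr := Plus (Minus e1 e2) (Minus e2 e1).
Definition rep (k : nat) (c : cmd) : cmd := iter k Rep c.

Definition For (x k : nat) (st : expr) (c : cmd) : cmd :=
  Seq (Assign x (Const 0)) (rep k (Seq c (Assign x (Plus (Var x) st)))).

Notation vI := 0 (only parsing).

Definition Fill (a : nat) (b c e1 e2 : expr) : cmd :=
  For vI 1 (Const 1) (If (Const 0) c (Store a (Plus b (Var vI)) e1) (Store a (Plus b (Var vI)) e2)).

(** For an involution this counts the edges, each at its smaller end. *)
Definition Count (a : nat) (e : expr) : cmd :=
  Seq (Assign a (Const 0))
    (For vI 1 (Const 1) (If (Var vI) e (Assign a (Plus (Var a) (Const 1))) Skip)).

Definition agree (L : seq nat) (s s' : state) : Prop :=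
  forall a i, a \notin L -> arr s' a i = arr s a i.

Section Rules.
Variable inp : seq nat.
Local Notation N := (size inp).+1.

Lemma sem_seq c1 c2 s : sem inp (Seq c1 c2) s = sem inp c2 (sem inp c1 s).
Proof. by []. Qed.

Lemma sem_assign a e s : sem inp (Assign a e) s = set_arr s a 0 (eval inp e s).
Proof. by []. Qed.

Lemma sem_if e1 e2 c1 c2 s : sem inp (If e1 e2 c1 c2) s =
  if eval inp e1 s < eval inp e2 s then sem inp c1 s else sem inp c2 s.
Proof. by []. Qed.

Lemma sem_frame c s a i : a \notin mods c -> arr (sem inp c s) a i = arr s a i.
Proof.
elim: c s => //= [b e1 e2|c1 IH1 c2 IH2|e1 e2 c1 IH1 c2 IH2|c IH] s.
- by rewrite inE => /negPf->.
- by rewrite mem_cat => /norP[a1 a2]; rewrite IH2 // IH1.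
- by rewrite mem_cat => /norP[a1 a2]; case: ifP => _; [rewrite IH1|rewrite IH2].
- move=> aN; rewrite IH //; elim: (size inp) => //= k IHk; by rewrite IH.
Qed.

Lemma sem_silent c s : silent c -> out (sem inp c s) = out s.
Proof.
elim: c s => //= [c1 IH1 c2 IH2|e1 e2 c1 IH1 c2 IH2|c IH] s.
- by case/andP => s1 s2; rewrite IH2 // IH1.
- by case/andP => s1 s2; case: ifP => _; [rewrite IH1|rewrite IH2].
- move=> sc; rewrite IH //; elim: (size inp) => //= k IHk; by rewrite IH.
Qed.

Lemma sem_rep k c s : sem inp (rep k c) s = iter (N ^ k) (sem inp c) s.
Proof.
elim: k s => [|k IH] s //; rewrite [rep _ _]/= -/(rep k c) [sem _ _ _]/=.
have it j t : iter j (sem inp (rep k c)) t = iter (j * N ^ k) (sem inp c) t.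
  by elim: j => //= j ->; rewrite IH mulSn iterD.
by rewrite -iterS it expnS.
Qed.

Lemma for_rule x k ste st c (I : nat -> state -> Prop) s :
  (forall s', eval inp ste s' = st) -> x \notin mods c ->
  I 0 (set_arr s x 0 0) ->
  (forall i s', i < N ^ k -> arr s' x 0 = i * st -> I i s' ->
     I i.+1 (set_arr (sem inp c s') x 0 (i.+1 * st))) ->
  I (N ^ k) (sem inp (For x k ste c) s).
Proof.
move=> Est xc I0 IS; rewrite /For [sem _ _ _]/= sem_rep.
set body := sem inp _.
have H i : i <= N ^ k -> I i (iter i body (set_arr s x 0 0)) /\
    arr (iter i body (set_arr s x 0 0)) x 0 = i * st.
  elim: i => [|i IH] ik; first by rewrite /= !eqxx.
  have [Ii xi] := IH (ltnW ik).
  have E : iter i.+1 body (set_arr s x 0 0) =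
    set_arr (sem inp c (iter i body (set_arr s x 0 0))) x 0 (i.+1 * st).
    by rewrite iterS {1}/body /= Est sem_frame // xi mulSn addnC.
  by rewrite E; split; [exact: IS | rewrite /= !eqxx].
by have [] := H (N ^ k) (leqnn _).
Qed.

Lemma fill_spec a b c e1 e2 s B (F : nat -> nat) : a != vI ->
  (forall i s', i < N -> agree [:: a; vI] s s' -> arr s' vI 0 = i ->
     eval inp b s' = B /\ (if 0 < eval inp c s' then eval inp e1 s' else eval inp e2 s') = F i) ->
  forall j, arr (sem inp (Fill a b c e1 e2) s) a j =
    if B <= j < B + N then F (j - B) else arr s a j.
Proof.
move=> av H.
pose I k s' := agree [:: a; vI] s s' /\
  forall j, arr s' a j = if B <= j < B + k then F (j - B) else arr s a j.
suff : I (N ^ 1) (sem inp (Fill a b c e1 e2) s) by rewrite expn1 => -[].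
apply: (@for_rule vI 1 (Const 1) 1 _ I) => //.
- by rewrite /= !inE orbb eq_sym.
- split=> [a' i|j]; first by rewrite !inE => /norP[_ /negPf h] /=; rewrite h.
  by rewrite /= (negPf av) /=; case: ifP => //; lia.
- rewrite expn1 => i s' iN; rewrite muln1 => si [ag Ha].
  have [EB EF] := H i s' iN ag si.
  have E : sem inp (If (Const 0) c (Store a (Plus b (Var vI)) e1) (Store a (Plus b (Var vI)) e2)) s'
    = set_arr s' a (B + i) (F i).
    by rewrite -EF /= si EB; case: ifP.
  rewrite E; split=> [a' j|j] /=.
    rewrite !inE => h; have /norP[/negPf h1 /negPf h2] := h.
    by rewrite h1 h2 /= ag // !inE h1 h2.
  rewrite (negPf av) /= eqxx /= Ha; case: eqP => [->|jBi].
    by rewrite leq_addr ltn_add2l ltnSn addKn.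
  by congr (if _ then _ else _); apply/idP/idP; lia.
Qed.

Lemma count_spec a e s (F : nat -> nat) : a != vI ->
  (forall i s', i < N -> agree [:: a; vI] s s' -> arr s' vI 0 = i -> eval inp e s' = F i) ->
  arr (sem inp (Count a e) s) a 0 = \sum_(i < N) (i < F i).
Proof.
move=> av H.
pose I k s' := agree [:: a; vI] s s' /\ arr s' a 0 = \sum_(i < k) (i < F i).
suff : I (N ^ 1) (sem inp (Count a e) s) by rewrite expn1 => -[].
rewrite /Count sem_seq sem_assign; apply: (@for_rule vI 1 (Const 1) 1 _ I) => //.
- by rewrite /= !inE eq_sym.
- split=> [a' i|]; last by rewrite /= (negPf av) /= !eqxx big_ord0.
  by rewrite !inE => /norP[/negPf h1 /negPf h2] /=; rewrite h1 h2.
- rewrite expn1 => i s' iN; rewrite muln1 => si [ag Ha].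
  rewrite /= si (H i s') //; split=> [a' j|].
    rewrite !inE => h; have /norP[/negPf h1 /negPf h2] := h.
    by rewrite /= h2 /=; case: ifP => _ /=; rewrite ?h1 /= ag // !inE h1 h2.
  rewrite /= (negPf av) /= big_ord_recr /= -Ha.
  by case: ifP => _ /=; rewrite ?eqxx ?addn0.
Qed.

End Rules.

(** * The table of matchings *)

Notation aRep := 1 (only parsing).
Notation aTab := 2 (only parsing).
Notation aCand := 3 (only parsing).
Notation aRes := 4 (only parsing).
Notation aKey := 5 (only parsing).
Notation aMark := 6 (only parsing).
Notation aOut := 7 (only parsing).
Notation vP1 := 8 (only parsing).
Notation vP2 := 9 (only parsing).
Notation vP := 10 (only parsing).
Notation vG := 11 (only parsing).
Notation vT := 12 (only parsing).
Notation vX := 13 (only parsing).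
Notation vY := 14 (only parsing).
Notation vZ := 15 (only parsing).
Notation vW := 16 (only parsing).
Notation vCur := 17 (only parsing).
Notation vNew := 18 (only parsing).
Notation vOld := 19 (only parsing).
Notation vJ := 20 (only parsing).
Notation vK := 21 (only parsing).
Notation vH := 22 (only parsing).

Definition MarkKeys : cmd :=
  Seq (Store aKey (Var vX) (Const 1)) (Seq (Store aKey (Var vY) (Const 1))
  (Seq (Store aKey (Var vZ) (Const 1)) (Store aKey (Var vW) (Const 1)))).

(** Deletes the edges of the candidate at the four keys and stores the result in the slot of these
    keys if it has more edges than the old entry. *)
Definition Offer : cmd :=
  Seq (Fill aKey (Const 0) (Const 0) (Const 0) (Const 0)) (Seq MarkKeys
  (Seq (Fill aRes (Const 0) (Plus (Get aKey (Var vI)) (Get aKey (Get aCand (Var vI))))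
          (Var vI) (Get aCand (Var vI)))
  (Seq (Count vNew (Get aRes (Var vI)))
  (Seq (Count vOld (Get aTab (Plus (Var vP) (Var vI))))
  (If (Var vOld) (Var vNew)
     (Fill aTab (Var vP) (Const 0) (Const 0) (Get aRes (Var vI))) Skip))))).

(** An odometer in base [N], run alongside the offset [vP] because the digits of a slot number
    cannot be recovered without division. The leading digit is not wrapped and ends at [N]. *)
Definition Increment : cmd :=
  Seq (Assign vW (Plus (Var vW) (Const 1)))
  (If (Var vW) LenS Skip
  (Seq (Assign vW (Const 0)) (Seq (Assign vZ (Plus (Var vZ) (Const 1)))
  (If (Var vZ) LenS Skip
  (Seq (Assign vZ (Const 0)) (Seq (Assign vY (Plus (Var vY) (Const 1)))
  (If (Var vY) LenS Skip
  (Seq (Assign vY (Const 0)) (Assign vX (Plus (Var vX) (Const 1))))))))))).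

Definition ResetKeys : cmd :=
  Seq (Assign vX (Const 0)) (Seq (Assign vY (Const 0))
  (Seq (Assign vZ (Const 0)) (Assign vW (Const 0)))).

Definition Register : cmd := Seq ResetKeys (For vP 4 LenS (Seq Offer Increment)).

(** Translates between the edges that the program counts and the unmatched vertices of the proof. *)
Lemma card_unmatched_size (k : nat) (m : 'I_k -> 'I_k) : involutive m ->
  #|unmatched m| + 2 * (\sum_(i < k) (i < m i)) = k.
Proof.
move=> mK; pose L := [set i : 'I_k | i < m i]; pose G := [set i : 'I_k | m i < i].
have -> : \sum_(i < k) (i < m i) = #|L|.
  by rewrite -sum1_card [RHS]big_mkcond; apply: eq_bigr => i _; rewrite inE; case: ifP.
have EG : #|G| = #|L|.
  rewrite -(card_imset L (inv_inj mK)); apply: eq_card => i; rewrite inE.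
  apply/idP/imsetP => [h|[j]]; first by exists (m i); rewrite ?inE mK.
  by rewrite inE => h ->; rewrite mK.
have U : L :|: G = ~: unmatched m.
  by apply/setP => i; rewrite !inE -neq_ltn eq_sym.
have I : L :&: G = set0.
  by apply/setP => i; rewrite !inE; case: ltngtP.
have := cardsC (unmatched m); have := cardsUI L G.
by rewrite U I cards0 EG card_ord; lia.
Qed.

Lemma notin_sub (L L' : seq nat) a : a \notin L' -> all (mem L') L -> a \notin L.
Proof. by move=> aL /allP LL; apply: contra aL => /LL. Qed.

Section Register.
Variable inp : seq nat.
Local Notation n := (size inp).
Local Notation N := (size inp).+1.
Implicit Types (s : state) (m : {ffun 'I_N -> 'I_N}).

Definition tab s (q : nat) : {ffun 'I_N -> 'I_N} := [ffun v : 'I_N => inord (arr s aTab (q * N + v))].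

Definition quad (x y z w : nat) : nat := ((x * N + y) * N + z) * N + w.

Definition keys (x y z w : 'I_N) : {set 'I_N} := [set x; y; z; w].

Lemma offer_spec s (x y z w : 'I_N) (c : {ffun 'I_N -> 'I_N}) :
  let q := quad x y z w in
  arr s vX 0 = x -> arr s vY 0 = y -> arr s vZ 0 = z -> arr s vW 0 = w ->
  arr s vP 0 = q * N -> (forall v : 'I_N, arr s aCand v = c v) ->
  (forall v : 'I_N, arr s aTab (q * N + v) < N) ->
  involutive c -> involutive (tab s q) ->
  let r := restrict (keys x y z w) c in
  forall j, arr (sem inp Offer s) aTab j =
    if (#|unmatched r| < #|unmatched (tab s q)|) && (q * N <= j < q * N + N)
    then nat_of_ord (r (inord (j - q * N))) else arr s aTab j.
Proof.
move=> q sx sy sz sw sp sc tlt cK tK r.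
rewrite /Offer 5!sem_seq; set s1 := sem _ (Fill _ _ _ _ _) s.
have k1 j : j < N -> arr s1 aKey j = 0.
  move=> jN; rewrite /s1 (@fill_spec _ _ _ _ _ _ _ 0 (fun _ => 0)) //.
  by rewrite add0n leq0n jN.
have f1 a i : a \notin [:: aKey; vI] -> arr s1 a i = arr s a i.
  by move=> h; rewrite /s1 sem_frame //; apply: notin_sub h _.
move: s1 k1 f1 => s1 k1 f1.
set s2 := sem _ MarkKeys s1.
have k2 (v : 'I_N) : (0 < arr s2 aKey v) = (v \in keys x y z w).
  have [x1 y1 z1 w1] : [/\ arr s1 vX 0 = x, arr s1 vY 0 = y, arr s1 vZ 0 = z & arr s1 vW 0 = w].
    by split; rewrite f1.
  rewrite /s2 /= x1 y1 z1 w1 !inE.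
  rewrite !(inj_eq val_inj).
  by rewrite -!orbA; do 4!(case: eqP => //=; rewrite ?orbT //); rewrite k1.
have f2 a i : a \notin [:: aKey; vI] -> arr s2 a i = arr s a i.
  by move=> h; rewrite /s2 sem_frame ?f1 //; apply: notin_sub h _.
move: s2 k2 f2 => s2 k2 f2 {s1 k1 f1}.
set s3 := sem _ (Fill _ _ _ _ _) s2.
have r3 (v : 'I_N) : arr s3 aRes v = r v.
  rewrite /s3 (@fill_spec _ _ _ _ _ _ _ 0 (fun v => nat_of_ord (r (inord v)))) //.
    by rewrite add0n leq0n ltn_ord subn0 inord_val.
  move=> i s' iN ag si; split=> //; rewrite /= si.
  have E : arr s' aCand i = c (inord i).
    by rewrite ag // f2 // -sc inordK.
  rewrite E !ag // addn_gt0 k2 -[X in arr s2 aKey X](inordK iN) k2 /r /restrict orbC.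
  by case: ifP => _ //; rewrite inordK.
have f3 a i : a \notin [:: aRes; aKey; vI] -> arr s3 a i = arr s a i.
  by move=> h; rewrite /s3 sem_frame ?f2 //; apply: notin_sub h _.
move: s3 r3 f3 => s3 r3 f3 {s2 k2 f2}.
set s4 := sem _ (Count _ _) s3.
have c4 : arr s4 vNew 0 = \sum_(i < N) (i < r i).
  rewrite /s4 (@count_spec _ _ _ _ (fun v => nat_of_ord (r (inord v)))) //.
    by apply: eq_bigr => i _; rewrite inord_val.
  by move=> i s' iN ag si; rewrite /= si ag // -r3 inordK.
have f4 a i : a \notin [:: vNew; aRes; aKey; vI] -> arr s4 a i = arr s a i.
  by move=> h; rewrite /s4 sem_frame ?f3 //; apply: notin_sub h _.
have r4 (v : 'I_N) : arr s4 aRes v = r v by rewrite /s4 sem_frame.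
move: s4 c4 f4 r4 => s4 c4 f4 r4 {s3 r3 f3}.
set s5 := sem _ (Count _ _) s4.
have c5 : arr s5 vOld 0 = \sum_(i < N) (i < tab s q i).
  rewrite /s5 (@count_spec _ _ _ _ (fun v => nat_of_ord (tab s q (inord v)))) //.
    by apply: eq_bigr => i _; rewrite inord_val.
  move=> i s' iN ag si; rewrite /= si ag // ag // !f4 // sp ffunE !inordK //.
  by rewrite -[X in _ + X](inordK iN) tlt.
have f5 a i : a \notin [:: vOld; vNew; aRes; aKey; vI] -> arr s5 a i = arr s a i.
  by move=> h; rewrite /s5 sem_frame ?f4 //; apply: notin_sub h _.
have r5 (v : 'I_N) : arr s5 aRes v = r v by rewrite /s5 sem_frame.
have c5' : arr s5 vNew 0 = \sum_(i < N) (i < r i) by rewrite /s5 sem_frame.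
move: s5 c5 f5 r5 c5' => s5 c5 f5 r5 c5' {s4 c4 f4 r4}.
have rK : involutive r by apply: restrict_involutive.
have cond : (arr s5 vOld 0 < arr s5 vNew 0) = (#|unmatched r| < #|unmatched (tab s q)|).
  move: (card_unmatched_size rK) (card_unmatched_size tK); rewrite c5 c5'.
  move: (\sum_(i < N) (i < r i)) (\sum_(i < N) (i < tab s q i)) => a b.
  move: #|unmatched r| #|unmatched (tab s q)| => a' b'.
  by clear; lia.
move=> j; rewrite sem_if -cond [eval _ _ _]/= [eval _ (Var vNew) _]/=.
case: ltnP => _; rewrite (andTb, andFb); last by rewrite f5.
rewrite (@fill_spec _ _ _ _ _ _ _ (q * N) (fun v => nat_of_ord (r (inord v)))) //.
  by rewrite f5.
move=> i s' iN ag si; split; first by rewrite /= ag // f5.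
by rewrite /= si ag // -r5 inordK.
Qed.

End Register.

Section Algorithm.
Variable inp : seq nat.
Local Notation n := (size inp).
Local Notation N := (size inp).+1.
Implicit Types (s : state) (m c : {ffun 'I_N -> 'I_N}).

Lemma block_range q q' v : v < N -> (q * N <= q' * N + v < q * N + N) = (q' == q).
Proof.
move=> vN; apply/idP/eqP => [/andP[h1 h2]|->]; last by rewrite leq_addr ltn_add2l.
by apply/eqP; rewrite eqn_leq; apply/andP; split;
  rewrite -ltnS -(ltn_pmul2r (ltn0Sn n)) mulSn; lia.
Qed.

Lemma digit_inj a b a' b' : b < N -> b' < N -> a * N + b = a' * N + b' -> a = a' /\ b = b'.
Proof.
move=> bN bN' E; have := block_range a' a bN; rewrite E leq_addr ltn_add2l bN'.
by move/esym/eqP => aa; split=> //; move: E; rewrite aa => /addnI.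
Qed.

Lemma digit_lt a b M : b < N -> (a * N + b < M * N) = (a < M).
Proof.
move=> bN; apply/idP/idP => h; last first.
  by apply: leq_trans (leq_mul h (leqnn N)); rewrite mulSn addnC ltn_add2r.
by rewrite -(ltn_pmul2r (ltn0Sn n)); apply: leq_ltn_trans h; rewrite leq_addr.
Qed.

Lemma quad_inj (x y z w : nat) (x' y' z' w' : nat) : y < N -> z < N -> w < N ->
  y' < N -> z' < N -> w' < N ->
  quad inp x y z w = quad inp x' y' z' w' -> [/\ x = x', y = y', z = z' & w = w'].
Proof.
move=> yN zN wN yN' zN' wN'; rewrite /quad => /(digit_inj wN wN')[+ ->].
by move/(digit_inj zN zN') => [+ ->] => /(digit_inj yN yN')[-> ->].
Qed.

Lemma quad_lt x y z w : y < N -> z < N -> w < N -> (quad inp x y z w < N ^ 4) = (x < N).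
Proof.
move=> yN zN wN; have -> : N ^ 4 = N * N * N * N by rewrite !expnSr expn0 mul1n.
by rewrite /quad !digit_lt.
Qed.

Lemma increment_spec s x y z w : arr s vX 0 = x -> arr s vY 0 = y -> arr s vZ 0 = z ->
  arr s vW 0 = w -> y < N -> z < N -> w < N ->
  let s' := sem inp Increment s in
  exists x' y' z' w', [/\ y' < N, z' < N, w' < N & quad inp x' y' z' w' = (quad inp x y z w).+1] /\
    [/\ arr s' vX 0 = x', arr s' vY 0 = y', arr s' vZ 0 = z' & arr s' vW 0 = w'].
Proof.
move=> sx sy sz sw yN zN wN; rewrite /= !addn1 sw.
case: ltnP => w1 /=; first by exists x, y, z, w.+1; rewrite sx sy sz /quad addnS.
have Ew : w.+1 = N by lia.
rewrite sz; case: ltnP => z1 /=.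
  exists x, y, z.+1, 0; rewrite sx sy; split=> //; split=> //.
  by rewrite /quad addnS mulSn -{2}Ew; lia.
have Ez : z.+1 = N by lia.
rewrite sy; case: ltnP => y1 /=.
  exists x, y.+1, 0, 0; rewrite sx; split=> //; split=> //.
  rewrite /quad -!addnS Ew addn0 -mulSnr -addnS Ez addn0 addnS !mulSnr; lia.
have Ey : y.+1 = N by lia.
exists x.+1, 0, 0, 0; rewrite sx; split=> //; split=> //.
by rewrite /quad -!addnS Ew !addn0 -mulSnr -addnS Ez -mulSnr -addnS Ey mulSnr; lia.
Qed.

Variable R : nat -> nat.
Hypothesis R_lt : forall i, R i < N.

(** The bigrams that start at [g] and [g.+1], counted from 0, overlap in the inner position [g.+1];
    [R] sends a start to the representative of its bigram. Numbers that represent no bigram are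
    isolated vertices. *)
Definition edge : rel 'I_N := fun u v => (u != v) &&
  [exists g : 'I_N, (g.+2 < n) &&
    ((R g == u) && (R g.+1 == v) || (R g == v) && (R g.+1 == u))].

Lemma edge_sym : symmetric edge.
Proof.
move=> u v; rewrite /edge eq_sym; congr (_ && _); apply: eq_existsb => g.
by rewrite orbC.
Qed.

Lemma edge_irr : irreflexive edge.
Proof. by move=> u; rewrite /edge eqxx. Qed.

Record table_ok s : Prop := TableOk {
  ok_rep : forall i, i < N -> arr s aRep i = R i;
  ok_lt : forall q v, q < N ^ 4 -> v < N -> arr s aTab (q * N + v) < N;
  ok_matching : forall q, q < N ^ 4 -> matching edge (tab inp s q);
  ok_keys : forall x y z w v : 'I_N, v \in keys x y z w -> tab inp s (quad inp x y z w) v = v }.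

(* Either some slot is strictly better than in [T0], or the table is still [T0] and
   [P] holds: [P] collects the absorption facts that a pass without progress establishes. *)
Definition progress (T0 : nat -> {ffun 'I_N -> 'I_N}) (P : Prop) s : Prop :=
  [/\ table_ok s,
      (forall q, q < N ^ 4 -> #|unmatched (tab inp s q)| <= #|unmatched (T0 q)|)
    & (exists2 q, q < N ^ 4 & #|unmatched (tab inp s q)| < #|unmatched (T0 q)|) \/
      (forall q, q < N ^ 4 -> tab inp s q = T0 q) /\ P].

Lemma tab_ext s s' : (forall j, arr s' aTab j = arr s aTab j) -> tab inp s' =1 tab inp s.
Proof. by move=> H q; apply/ffunP => v; rewrite !ffunE H. Qed.

Lemma table_ok_frame s s' : (forall j, arr s' aRep j = arr s aRep j) ->
  (forall j, arr s' aTab j = arr s aTab j) -> table_ok s -> table_ok s'.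
Proof.
move=> HR HT [h1 h2 h3 h4]; have E := tab_ext HT.
split=> [i iN|q v qN vN|q qN|x y z w v vk]; rewrite ?HR ?HT ?E; auto.
Qed.

Lemma progress_frame T0 P s s' : (forall j, arr s' aRep j = arr s aRep j) ->
  (forall j, arr s' aTab j = arr s aTab j) -> progress T0 P s -> progress T0 P s'.
Proof.
move=> HR HT [hok hle hor]; have E := tab_ext HT; split.
- exact: table_ok_frame hok.
- by move=> q qN; rewrite E hle.
- case: hor => [[q qN lt]|[eqT p]]; [left; exists q => //; by rewrite E|right].
  by split=> // q qN; rewrite E eqT.
Qed.

Lemma progress_imp T0 (P P' : Prop) s : (P -> P') -> progress T0 P s -> progress T0 P' s.
Proof. by move=> PP [h1 h2 [h3|[h3 h4]]]; split=> //; [left|right; auto]. Qed.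

Lemma progress_cases T0 P s : progress T0 P s ->
  (forall P', progress T0 P' s) \/ ((forall q, q < N ^ 4 -> tab inp s q = T0 q) /\ P).
Proof. by move=> [h1 h2 [h3|h3]]; [left=> P'; split=> //; left|right]. Qed.

Lemma restrict_matching X (m : 'I_N -> 'I_N) : matching edge m -> matching edge (restrict X m).
Proof.
move=> [mK mE]; split; first exact: restrict_involutive.
by move=> v; rewrite /restrict; case: ifP => [|_]; [rewrite eqxx | exact: mE].
Qed.

Definition absorbs (T0 : nat -> {ffun 'I_N -> 'I_N}) (c : 'I_N -> 'I_N) : Prop :=
  forall x y z w : 'I_N,
    #|unmatched (T0 (quad inp x y z w))| <= #|unmatched (restrict (keys x y z w) c)|.

Lemma unmatched_ext (f g : 'I_N -> 'I_N) : f =1 g -> unmatched f = unmatched g.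
Proof. by move=> fg; apply/setP => v; rewrite !inE fg. Qed.

(** Either the slot is overwritten, which is a strict improvement, or the failed comparison is
    itself the desired inequality, as long as the table is still [T0]. *)
Lemma offer_progress T0 (P : Prop) s c (x y z w : 'I_N) :
  arr s vX 0 = x -> arr s vY 0 = y -> arr s vZ 0 = z -> arr s vW 0 = w ->
  arr s vP 0 = quad inp x y z w * N -> (forall v : 'I_N, arr s aCand v = c v) ->
  matching edge c -> progress T0 P s ->
  progress T0 (P /\ #|unmatched (T0 (quad inp x y z w))| <=
                    #|unmatched (restrict (keys x y z w) c)|) (sem inp Offer s).
Proof.
move=> sx sy sz sw sp sc cM pr; have [hok hle hor] := pr.
set q := quad inp x y z w; set r := restrict _ _.
have qN : q < N ^ 4 by rewrite quad_lt.
have rM : matching edge r := restrict_matching _ cM.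
have HT := offer_spec sx sy sz sw sp sc (fun v => ok_lt hok qN (ltn_ord v)) (proj1 cM)
  (proj1 (ok_matching hok qN)); cbv zeta in HT; rewrite -/q -/r in HT.
have HR j : arr (sem inp Offer s) aRep j = arr s aRep j by rewrite sem_frame.
move: (sem inp Offer s) HR HT => s' HR.
case: (ltnP #|unmatched r| #|unmatched (tab inp s q)|) => cmp HT; last first.
  apply: (progress_frame HR HT); split=> //; case: hor => [|[hT p]]; [by left|right].
  by split=> //; split=> //; rewrite -hT.
have Tq : tab inp s' q = [ffun v => r v].
  apply/ffunP => v; rewrite !ffunE HT block_range // eqxx andbT /= addKn.
  by rewrite !inord_val.
have To q' : q' != q -> tab inp s' q' = tab inp s q'.
  by move=> qq; apply/ffunP => v; rewrite !ffunE HT block_range // (negPf qq).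
have ur : unmatched [ffun v => r v] = unmatched r.
  by apply: unmatched_ext => v; rewrite ffunE.
split; last by left; exists q; rewrite // Tq ur (leq_trans cmp) // hle.
- split=> [i iN|q' v qN' vN|q' qN'|x' y' z' w' v vk].
  + by rewrite HR (ok_rep hok).
  + by rewrite HT block_range //; case: ifP => _; [rewrite ltn_ord | rewrite (ok_lt hok)].
  + have [->|qq] := eqVneq q' q; last by rewrite To //; exact: ok_matching.
    rewrite Tq; case: rM => rK rE.
    by split=> v; rewrite !ffunE; [exact: rK | exact: rE].
  + have [qq|qq] := eqVneq (quad inp x' y' z' w') q; last by rewrite To //; exact: ok_keys.
    have [/val_inj ex /val_inj ey /val_inj ez /val_inj ew] :=
      quad_inj (ltn_ord y') (ltn_ord z') (ltn_ord w') (ltn_ord y) (ltn_ord z) (ltn_ord w) qq.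
    by rewrite qq Tq ffunE /r /restrict -ex -ey -ez -ew vk.
- move=> q' qN'; have [->|qq] := eqVneq q' q; last by rewrite To // hle.
  by rewrite Tq ur ltnW // (leq_trans cmp) // hle.
Qed.

Lemma register_spec T0 (P : Prop) s c :
  (forall v : 'I_N, arr s aCand v = c v) -> matching edge c -> progress T0 P s ->
  progress T0 (P /\ absorbs T0 c) (sem inp Register s).
Proof.
move=> sc cM pr.
pose P' k := P /\ forall x y z w : 'I_N, quad inp x y z w < k ->
  #|unmatched (T0 (quad inp x y z w))| <= #|unmatched (restrict (keys x y z w) c)|.
pose I k s' := [/\ progress T0 (P' k) s', (forall v : 'I_N, arr s' aCand v = c v) &
  exists x y z w, [/\ y < N, z < N, w < N & quad inp x y z w = k] /\
    [/\ arr s' vX 0 = x, arr s' vY 0 = y, arr s' vZ 0 = z & arr s' vW 0 = w]].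
suff [+ _ _] : I (N ^ 4) (sem inp Register s).
  apply: progress_imp => -[p H]; split=> // x y z w; apply: H.
  by rewrite quad_lt.
rewrite /Register sem_seq; apply: (@for_rule _ vP 4 LenS N _ I).
- by move=> s'; rewrite /= addn1.
- by [].
- split=> [||]; last by exists 0, 0, 0, 0.
  + by apply: progress_frame (progress_imp _ pr).
  + by move=> v; exact: sc.
- move=> k s' kN sp [pr' sc' [x [y [z [w [[yN zN wN qk] [sx sy sz sw]]]]]]].
  have xN : x < N by rewrite -(quad_lt x yN zN wN) qk.
  rewrite sem_seq; set s1 := sem inp Offer s'.
  have pr1 : progress T0 (P' k.+1) s1.
    have Hq : quad inp (Ordinal xN) (Ordinal yN) (Ordinal zN) (Ordinal wN) = k := qk.
    have := @offer_progress T0 (P' k) s' c (Ordinal xN) (Ordinal yN) (Ordinal zN) (Ordinal wN)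
      sx sy sz sw _ sc' cM pr'.
    rewrite Hq => /(_ sp); apply: progress_imp => -[[p H] Hk]; split=> // x' y' z' w'.
    rewrite ltnS leq_eqVlt => /orP[/eqP E|]; last exact: H.
    have [ex ey ez ew] := quad_inj (ltn_ord y') (ltn_ord z') (ltn_ord w') yN zN wN (etrans E (esym qk)).
    have -> : x' = Ordinal xN by apply: val_inj.
    have -> : y' = Ordinal yN by apply: val_inj.
    have -> : z' = Ordinal zN by apply: val_inj.
    have -> : w' = Ordinal wN by apply: val_inj.
    by rewrite Hq.
  have [x1 y1 z1 w1] : [/\ arr s1 vX 0 = x, arr s1 vY 0 = y, arr s1 vZ 0 = z & arr s1 vW 0 = w].
    by split; rewrite /s1 sem_frame.
  have sc1 (v : 'I_N) : arr s1 aCand v = c v by rewrite /s1 sem_frame.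
  move: s1 pr1 x1 y1 z1 w1 sc1 => s1 pr1 x1 y1 z1 w1 sc1.
  have [x2 [y2 [z2 [w2 [[yN2 zN2 wN2 q2] [sx2 sy2 sz2 sw2]]]]]] :=
    increment_spec x1 y1 z1 w1 yN zN wN.
  have F a j : a \notin [:: vX; vY; vZ; vW] -> arr (sem inp Increment s1) a j = arr s1 a j.
    by move=> h; rewrite sem_frame //; apply: notin_sub h _.
  move: (sem inp Increment s1) sx2 sy2 sz2 sw2 F => s2 sx2 sy2 sz2 sw2 F.
  split.
  + by apply: progress_frame pr1 => j /=; rewrite F.
  + by move=> v /=; rewrite F.
  + by exists x2, y2, z2, w2; rewrite q2 qk.
Qed.

End Algorithm.

(** * One pass: all edge additions and all exchanges *)

Definition EdgeL : expr := Get aRep (Var vG).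
Definition EdgeR : expr := Get aRep (Plus (Var vG) (Const 1)).
Definition Slot (p : nat) (e : expr) : expr := Get aTab (Plus (Var p) e).

Definition AddEdge : cmd :=
  Seq (Fill aCand (Const 0) (Const 0) (Const 0) (Slot vP1 (Var vI)))
  (If (Plus (Var vG) (Const 2)) Len
    (If (Plus (Dist (Get aCand EdgeL) EdgeL) (Dist (Get aCand EdgeR) EdgeR)) (Const 1)
      (Seq (Store aCand EdgeL EdgeR) (Store aCand EdgeR EdgeL)) Skip) Skip).

Definition MarkOrbit : cmd :=
  Seq (Assign vCur (Var vT))
  (Rep (Seq (Store aMark (Var vCur) (Const 1)) (Assign vCur (Slot vP1 (Slot vP2 (Var vCur)))))).

Definition Switch : cmd :=
  Seq (Fill aMark (Const 0) (Const 0) (Const 0) (Const 0))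
  (Seq (If (Const 0) (Plus (Minus (Const 1) (Dist (Slot vP1 (Var vT)) (Var vT)))
                           (Minus (Const 1) (Dist (Slot vP2 (Var vT)) (Var vT))))
         MarkOrbit Skip)
  (Fill aCand (Const 0) (Get aMark (Var vI)) (Slot vP1 (Var vI)) (Slot vP2 (Var vI)))).

Definition Pass : cmd :=
  For vP1 4 LenS
    (Seq (For vG 1 (Const 1) (Seq AddEdge Register))
         (For vP2 4 LenS (For vT 1 (Const 1) (Seq Switch Register)))).

Section Passes.
Variable inp : seq nat.
Local Notation n := (size inp).
Local Notation N := (size inp).+1.
Variable R : nat -> nat.
Hypothesis R_lt : forall i, R i < N.
Implicit Types (s : state) (m c : {ffun 'I_N -> 'I_N}).
Local Notation edge := (@edge inp R).
Local Notation tab := (tab inp).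

Definition addop (g : nat) m : {ffun 'I_N -> 'I_N} :=
  if [&& g.+2 < n, m (inord (R g)) == inord (R g) & m (inord (R g.+1)) == inord (R g.+1)]
  then [ffun x => add_edge m (inord (R g)) (inord (R g.+1)) x] else m.

(** If [t] is matched in both, its orbit need not be a whole alternating component; the empty set
    then keeps the result a matching. *)
Definition swop m m' (t : 'I_N) : {ffun 'I_N -> 'I_N} :=
  [ffun v => switch (if (m t == t) || (m' t == t) then orb m m' t else set0) m m' v].

Lemma tabE s q (v : 'I_N) : table_ok inp R s -> q < N ^ 4 ->
  arr s aTab (q * N + v) = tab s q v.
Proof. by move=> hok qN; rewrite ffunE inordK // (ok_lt hok). Qed.

Lemma dist_eq0 a b : (a - b + (b - a) == 0) = (a == b).
Proof. by apply/eqP/eqP; lia. Qed.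

Lemma addop_spec s q g : table_ok inp R s -> q < N ^ 4 -> g < N ->
  arr s vP1 0 = q * N -> arr s vG 0 = g ->
  forall v : 'I_N, arr (sem inp AddEdge s) aCand v = addop g (tab s q) v.
Proof.
move=> hok qN gN sp sg v; rewrite /AddEdge sem_seq.
set s1 := sem _ (Fill _ _ _ _ _) s.
have c1 (u : 'I_N) : arr s1 aCand u = tab s q u.
  rewrite /s1 (@fill_spec _ _ _ _ _ _ _ 0 (fun u => nat_of_ord (tab s q (inord u)))) //.
    by rewrite add0n leq0n ltn_ord subn0 inord_val.
  by move=> i s' iN ag si; split=> //; rewrite /= si !ag // sp -tabE // inordK.
have f1 a i : a \notin [:: aCand; vI] -> arr s1 a i = arr s a i.
  by move=> h; rewrite /s1 sem_frame //; apply: notin_sub h _.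
move: s1 c1 f1 => s1 c1 f1.
have sg1 : arr s1 vG 0 = g by rewrite f1.
rewrite /addop /= sg1 addn2 addn1.
case: ltnP => g2; last by rewrite /= c1.
have r1 : arr s1 aRep g = (inord (R g) : 'I_N) by rewrite f1 // (ok_rep hok) // inordK.
have r2 : arr s1 aRep g.+1 = (inord (R g.+1) : 'I_N).
  by rewrite f1 // (ok_rep hok) ?inordK //; lia.
rewrite r1 r2 !c1 ltnS leqn0 addn_eq0 !dist_eq0 !(inj_eq val_inj) /=.
case: ifP => _ /=; last exact: c1.
rewrite ffunE /add_edge !(inj_eq val_inj).
by case: eqP => [E1|_]; case: eqP => [E2|_] //; rewrite ?c1 // -E1 -E2.
Qed.

Lemma addop_matching g m : matching edge m -> matching edge (addop g m).
Proof.
move=> mM; rewrite /addop; case: ifP => // /and3P[g2 /eqP mu /eqP mv].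
set u := inord (R g) in mu *; set v := inord (R g.+1) in mv *.
have [mK mE] := mM; split=> x; rewrite !ffunE; first exact: add_edge_involutive.
(* Overlapping occurrences of one bigram, as in a run of three equal letters, give [u = v]; adding
   this loop changes nothing. *)
have [uv|uv] := eqVneq u v.
  have -> : add_edge m u v x = m x.
    by rewrite /add_edge -uv; case: eqP => // ->; rewrite mu.
  exact: mE.
have euv : edge u v.
  rewrite /edge uv; apply/existsP; have gN : g < N by lia.
  by exists (Ordinal gN); rewrite g2 /u /v !inordK // !eqxx.
rewrite /add_edge; have [->|_] // := eqVneq x u; have [->|_] := eqVneq x v.
  by rewrite edge_sym.
exact: mE.
Qed.

Lemma swop_spec s q q' (t : 'I_N) : table_ok inp R s -> q < N ^ 4 -> q' < N ^ 4 ->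
  arr s vP1 0 = q * N -> arr s vP2 0 = q' * N -> arr s vT 0 = t ->
  forall v : 'I_N, arr (sem inp Switch s) aCand v = swop (tab s q) (tab s q') t v.
Proof.
move=> hok qN qN' sp sp' st v; rewrite /Switch 2!sem_seq.
set s1 := sem _ (Fill _ _ _ _ _) s.
have k1 (j : 'I_N) : arr s1 aMark j = 0.
  rewrite /s1 (@fill_spec _ _ _ _ _ _ _ 0 (fun _ => 0)) //.
  by rewrite add0n leq0n ltn_ord.
have f1 a i : a \notin [:: aMark; vI] -> arr s1 a i = arr s a i.
  by move=> h; rewrite /s1 sem_frame //; apply: notin_sub h _.
move: s1 k1 f1 => s1 k1 f1.
set s2 := sem _ (If _ _ _ _) s1.
set C := if (tab s q t == t) || (tab s q' t == t) then orb (tab s q) (tab s q') t else set0.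
have k2 (j : 'I_N) : (0 < arr s2 aMark j) = (j \in C).
  rewrite /s2 sem_if.
  have -> : (eval inp (Const 0) s1 <
     eval inp (Plus (Minus (Const 1) (Dist (Slot vP1 (Var vT)) (Var vT)))
        (Minus (Const 1) (Dist (Slot vP2 (Var vT)) (Var vT)))) s1) =
     (tab s q t == t) || (tab s q' t == t).
    rewrite /= !f1 // sp sp' st !tabE // addn_gt0 !subn_gt0 !ltnS !leqn0.
    by rewrite !dist_eq0 !(inj_eq val_inj).
  rewrite /C; case: ifP => _; last by rewrite k1 inE.
  rewrite /MarkOrbit sem_seq.
  set m := tab s q; set m' := tab s q'.
  have H k : let s' := iter k (sem inp (Seq (Store aMark (Var vCur) (Const 1))
        (Assign vCur (Slot vP1 (Slot vP2 (Var vCur)))))) (sem inp (Assign vCur (Var vT)) s1) in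
      [/\ arr s' vCur 0 = iter k (m \o m') t,
        (forall i : 'I_N, (0 < arr s' aMark i) = [exists j : 'I_k, i == iter j (m \o m') t])
        & forall a i, a \notin [:: aMark; vI; vCur] -> arr s' a i = arr s a i].
    elim: k => [|k [IH1 IH2 IH3]].
      split=> [|i|a i h] /=; first by rewrite f1.
        by rewrite k1; apply/esym/existsP => -[[]].
      move: h; rewrite !inE => /norP[h1 /norP[h2 /negPf h3]]; rewrite h3 /= f1 //.
      by rewrite !inE (negPf h1) (negPf h2).
    rewrite iterS; move: (iter k _ _) IH1 IH2 IH3 => s' IH1 IH2 IH3; split=> [|i|a i h] /=.
    - by rewrite IH1 !IH3 // sp sp' !tabE.
    - rewrite IH1; apply/idP/existsP.
        case: eqP => [E _|_]; first by exists ord_max; apply/eqP/val_inj.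
        by rewrite IH2 => /existsP[l /eqP->]; exists (widen_ord (leqnSn k) l).
      case=> l /eqP->; case: (unliftP ord_max l) => [l' ->|->] /=; last by rewrite eqxx.
      case: ifP => // _; rewrite IH2; apply/existsP; exists l'.
      by apply/eqP; congr (iter _ _ t); rewrite /= /bump leqNgt ltn_ord.
    - have h' := h; move: h; rewrite !inE => /norP[/negPf h1 /norP[_ /negPf h3]].
      by rewrite h1 h3 /= IH3.
  (* [Rep] makes exactly [N] steps, as many as there are vertices, so the whole orbit is marked. *)
  have [_ -> _] := H N; rewrite orb_iter.
  by apply/existsP/existsP; rewrite card_ord => -[i E]; exists i.
have f2 a i : a \notin [:: aMark; vI; vCur] -> arr s2 a i = arr s a i.
  by move=> h; rewrite /s2 sem_frame ?f1 //; apply: notin_sub h _.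
move: s2 k2 f2 => s2 k2 f2.
rewrite (@fill_spec _ _ _ _ _ _ _ 0
  (fun u => nat_of_ord (swop (tab s q) (tab s q') t (inord u)))) //.
  by rewrite add0n leq0n ltn_ord subn0 inord_val.
move=> i s' iN ag si; split=> //; rewrite /= si !ag //.
rewrite !(f2 aTab) // (f2 vP1) // (f2 vP2) // sp sp'.
have -> : i = Ordinal iN by [].
by rewrite inord_val k2 !tabE // [swop _ _ _ _]ffunE /switch -/C; case: ifP.
Qed.

Lemma swop_matching m m' t : matching edge m -> matching edge m' ->
  matching edge (swop m m' t).
Proof.
move=> [mK mE] [mK' mE']; rewrite /swop; set C := (if _ then _ else _).
have cl x : x \in C -> (m x \in C) && (m' x \in C).
  rewrite /C; case: ifP => [h|_]; last by rewrite inE.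
  by apply: orb_closed => //; case/orP: h => /eqP; [left|right].
split=> x; rewrite !ffunE; first exact: switch_involutive.
by rewrite /switch; case: ifP => _; [exact: mE | exact: mE'].
Qed.

(** Candidates are computed from the current table, while absorption is claimed for [T0]. If the two
    differ, a slot has already improved and the claim is void; if they agree, so do the
    candidates. *)
Lemma op_register T0 (P : Prop) s op (F : (nat -> {ffun 'I_N -> 'I_N}) -> {ffun 'I_N -> 'I_N}) :
  aRep \notin mods op -> aTab \notin mods op ->
  (forall v : 'I_N, arr (sem inp op s) aCand v = F (tab s) v) -> matching edge (F (tab s)) ->
  ((forall q, q < N ^ 4 -> tab s q = T0 q) -> F (tab s) = F T0) ->
  progress R T0 P s -> progress R T0 (P /\ absorbs T0 (F T0)) (sem inp (Seq op Register) s).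
Proof.
move=> mR mT Hc HM HF pr; rewrite sem_seq.
have fr Q : progress R T0 Q s -> progress R T0 Q (sem inp op s).
  by apply: progress_frame => j; rewrite sem_frame.
case: (progress_cases pr) => [H|[/HF E _]].
  apply: progress_imp (register_spec Hc HM (fr _ (H (P /\ absorbs T0 (F T0))))).
  by case.
by rewrite -E; apply: register_spec => //; apply: fr.
Qed.

Definition closed_table (T0 : nat -> {ffun 'I_N -> 'I_N}) : Prop :=
  forall q, q < N ^ 4 ->
    (forall g, g < N -> absorbs T0 (addop g (T0 q))) /\
    (forall q' (t : 'I_N), q' < N ^ 4 -> absorbs T0 (swop (T0 q) (T0 q') t)).

Lemma pass_spec T0 s : progress R T0 True s ->
  progress R T0 (closed_table T0) (sem inp Pass s).
Proof.
move=> pr.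
pose C k := forall q, q < k ->
    (forall g, g < N -> absorbs T0 (addop g (T0 q))) /\
    (forall q' (t : 'I_N), q' < N ^ 4 -> absorbs T0 (swop (T0 q) (T0 q') t)).
apply: (@for_rule inp vP1 4 LenS N _ (fun k => progress R T0 (C k))).
- by move=> s'; rewrite /= addn1.
- by [].
- by apply: progress_frame (progress_imp _ pr).
move=> q s1 qN sp pr1; rewrite sem_seq.
set s2 := sem inp (For vG _ _ _) s1.
pose C1 k := C q /\ forall g, g < k -> absorbs T0 (addop g (T0 q)).
have [pr2 sp2] : progress R T0 (C1 N) s2 /\ arr s2 vP1 0 = q * N.
  pose I k s' := progress R T0 (C1 k) s' /\ arr s' vP1 0 = q * N.
  suff : I (N ^ 1) s2 by rewrite expn1.
  apply: (@for_rule inp vG 1 (Const 1) 1 _ I) => //.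
    by split=> //; apply: progress_frame (progress_imp _ pr1).
  rewrite expn1 => g s' gN; rewrite muln1 => sg [pr' sp'].
  have hok : table_ok inp R s' by case: pr'.
  split; last exact: etrans (@sem_frame inp (Seq AddEdge Register) s' vP1 0 isT) sp'.
  have := @op_register T0 (C1 g) s' AddEdge (fun T => addop g (T q)) isT isT
    (addop_spec hok qN gN sp' sg) (addop_matching g (ok_matching hok qN)) _ pr'.
  move=> H; apply: progress_frame (progress_imp _ (H _)) => //; last by move=> ->.
  move=> [[c1 c2] ab]; split=> // g'; rewrite ltnS leq_eqVlt => /orP[/eqP->//|]; exact: c2.
move: s2 pr2 sp2 => s2 pr2 sp2.
pose C2 k := C1 N /\ forall q' (t : 'I_N), q' < k -> absorbs T0 (swop (T0 q) (T0 q') t).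
pose I k s' := progress R T0 (C2 k) s' /\ arr s' vP1 0 = q * N.
suff [] : I (N ^ 4) (sem inp (For vP2 4 LenS (For vT 1 (Const 1) (Seq Switch Register))) s2).
  move: (sem _ _ _) => s3 pr3 _.
  apply: progress_frame (progress_imp _ pr3) => // -[[c1 c2] c3] q'.
  rewrite ltnS leq_eqVlt => /orP[/eqP->//|]; exact: c1.
apply: (@for_rule inp vP2 4 LenS N _ I) => //.
- by move=> s'; rewrite /= addn1.
- by split=> //; apply: progress_frame (progress_imp _ pr2).
move=> q' s3 qN' sq' [pr3 sp3].
pose C3 k := C2 q' /\ forall t : 'I_N, t < k -> absorbs T0 (swop (T0 q) (T0 q') t).
pose I' k s' := [/\ progress R T0 (C3 k) s', arr s' vP1 0 = q * N & arr s' vP2 0 = q' * N].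
suff [] : I' (N ^ 1) (sem inp (For vT 1 (Const 1) (Seq Switch Register)) s3).
  move: (sem _ _ _) => s4; rewrite expn1 => pr4 sp4 _; split=> //.
  apply: progress_frame (progress_imp _ pr4) => // -[[c1 c2] c3]; split=> // q'' t.
  rewrite ltnS leq_eqVlt => /orP[/eqP->|]; [exact: c3 | exact: c2].
apply: (@for_rule inp vT 1 (Const 1) 1 _ I') => //.
  by split=> //; apply: progress_frame (progress_imp _ pr3).
rewrite expn1 => t s' tN; rewrite muln1 => st [pr' sp' sq''].
have hok : table_ok inp R s' by case: pr'.
split.
- have := @op_register T0 (C3 t) s' Switch (fun T => swop (T q) (T q') (Ordinal tN)) isT isT
    (@swop_spec s' q q' (Ordinal tN) hok qN qN' sp' sq'' st)
    (swop_matching _ (ok_matching hok qN) (ok_matching hok qN')) _ pr'.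
  move=> H; apply: progress_frame (progress_imp _ (H _)) => //; last by move=> E; rewrite !E.
  move=> [[c1 c2] ab]; split=> // t'; rewrite ltnS leq_eqVlt => /orP[/eqP E|]; last exact: c2.
  by have -> : t' = Ordinal tN by apply: val_inj.
- exact: etrans (@sem_frame inp (Seq Switch Register) s' vP1 0 isT) sp'.
- exact: etrans (@sem_frame inp (Seq Switch Register) s' vP2 0 isT) sq''.
Qed.

End Passes.

(** * A stable table holds a maximum matching, and enough passes reach one *)

Definition Passes : cmd := Seq (rep 5 Pass) Pass.

Section Maximum.
Variable inp : seq nat.
Local Notation n := (size inp).
Local Notation N := (size inp).+1.
Variable R : nat -> nat.
Hypothesis R_lt : forall i, R i < N.
Hypothesis R_valid : forall i, i.+1 < n -> R i < n.
Implicit Types (s : state) (m c : {ffun 'I_N -> 'I_N}).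
Local Notation edge := (@edge inp R).
Local Notation tab := (tab inp).
Local Notation table_ok := (table_ok inp R).

(* Vertex [n] is no bigram, hence isolated: avoiding it is no restriction. *)
Definition free_slot : nat := quad inp n n n n.

Lemma free_slot_lt : free_slot < N ^ 4.
Proof. by rewrite quad_lt. Qed.

Lemma last_isolated (m : 'I_N -> 'I_N) : matching edge m -> m ord_max = ord_max.
Proof.
move=> [_ mE]; apply/eqP/negPn/negP => /mE /andP[_ /existsP[g /andP[g2]]].
have r1 : R g < n by apply: R_valid; lia.
have r2 : R g.+1 < n by apply: R_valid.
by case/orP => /andP[/eqP e1 /eqP e2]; move: r1 r2; rewrite e1 e2 /= ltnn.
Qed.

(** Smaller sets are padded by repeating a vertex; the empty set is left to [free_slot]. *)
Lemma keysP (X : {set 'I_N}) : #|X| <= 4 -> X != set0 -> exists x y z w, X = keys x y z w.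
Proof.
rewrite cardE => X4 /set0Pn[x0]; have H v : (v \in X) = (v \in enum X) by rewrite mem_enum.
rewrite H; move: X4; case E : (enum X) => [|a [|b [|c [|d [|? ?]]]]] // _ _.
- by exists a, a, a, a; apply/setP => v; rewrite H E !inE !orbb.
- by exists a, b, b, b; apply/setP => v; rewrite H E !inE -!orbA !orbb.
- by exists a, b, c, c; apply/setP => v; rewrite H E !inE -!orbA !orbb.
- by exists a, b, c, d; apply/setP => v; rewrite H E !inE -!orbA.
Qed.

Lemma closed_maximum s (m : 'I_N -> 'I_N) : table_ok s -> closed_table R (tab s) ->
  matching edge m -> #|unmatched (tab s free_slot)| <= #|unmatched m|.
Proof.
move=> hok cl mM; set T := tab s.
pose K := [set T (val q) | q : 'I_(N ^ 4)].
have KP c : c \in K -> exists2 q, q < N ^ 4 & c = T q.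
  by case/imsetP => q _ ->; exists (val q) => //; exact: ltn_ord.
have TK q : q < N ^ 4 -> T q \in K by move=> qN; apply/imsetP; exists (Ordinal qN).
have KM c : c \in K -> matching edge c by case/KP => q qN ->; exact: ok_matching.
have res (c : 'I_N -> 'I_N) : matching edge c -> restrict (keys ord_max ord_max ord_max ord_max) c =1 c.
  move=> cM v; have cl0 := last_isolated cM; rewrite /restrict /keys !inE !orbb.
  case: ifP => // /orP[/eqP->//|/eqP E]; rewrite E; case: cM => cK _.
  by rewrite -(cK v) E cl0.
have abs (c : 'I_N -> 'I_N) : matching edge c -> absorbs T c -> absorbed K c.
  move=> cM ab X X4; have [->|X0] := eqVneq X set0.
    exists (T free_slot); first exact: TK free_slot_lt.
    split=> [x|]; first by rewrite inE.
    have -> : unmatched (restrict set0 c) = unmatched c.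
      by apply: unmatched_ext => v; rewrite /restrict !inE.
    by rewrite -(unmatched_ext (res _ cM)); apply: (ab ord_max ord_max ord_max ord_max).
  have [x [y [z [w E]]]] := keysP X4 X0.
  exists (T (quad inp x y z w)); first by apply: TK; rewrite quad_lt.
  by split=> [v|]; rewrite E; [exact: (ok_keys hok) | exact: ab].
(* At [g = n] the test [g.+2 < n] fails, so [addop] returns its argument and closure under it is
   absorption of the entry itself. *)
have self c : c \in K -> absorbs T c.
  case/KP => q qN ->; have [+ _] := cl q qN => /(_ n (ltnSn _)).
  by rewrite /addop ltnNge (leq_trans (leqnSn n) (leqnSn _)).
pose mf : {ffun 'I_N -> 'I_N} := [ffun v => m v].
have mfM : matching edge mf by case: mM => mK mE; split=> v; rewrite !ffunE; [exact: mK | exact: mE].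
have -> : unmatched m = unmatched mf by apply: unmatched_ext => v; rewrite ffunE.
apply: (@absorbing_family_maximum _ edge _ _ K) => //.
- exact: edge_sym.
- exact: edge_irr.
- by move=> c cK; apply: abs (self _ cK); apply: KM.
- move=> c u v cK euv cu cv; have uv : u != v by case/andP: euv.
  have add_sym : add_edge c v u =1 add_edge c u v.
    move=> x; rewrite /add_edge; have [->|_] := eqVneq x v => //.
    by rewrite eq_sym (negPf uv).
  have addM : matching edge (add_edge c u v).
    have [cI cE] := KM c cK; split; first exact: add_edge_involutive.
    move=> x; rewrite /add_edge; have [->|_] // := eqVneq x u; have [->|_] := eqVneq x v.
      by rewrite edge_sym.
    exact: cE.
  apply: abs => //; have [q qN Ec] := KP c cK.
  have /andP[_ /existsP[g /andP[g2 H]]] := euv.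
  have [+ _] := cl q qN => /(_ g (ltn_ord g)); rewrite /addop -/T -Ec g2 /=.
  case/orP: H => /andP[/eqP-> /eqP->]; rewrite !inord_val cu cv !eqxx /= => ab x y z w.
    apply: leq_trans (ab x y z w) _; rewrite (unmatched_ext (g := restrict (keys x y z w) (add_edge c u v))) //.
    by move=> t; rewrite /restrict ffunE.
  apply: leq_trans (ab x y z w) _; rewrite (unmatched_ext (g := restrict (keys x y z w) (add_edge c u v))) //.
  by move=> t; rewrite /restrict ffunE add_sym.
- move=> c c' t cK cK' ht.
  have [cI cE] := KM c cK; have [cI' cE'] := KM c' cK'.
  apply: abs.
    have cl' := orb_closed cI cI' ht.
    split; first exact: switch_involutive.
    by move=> v; rewrite /switch; case: ifP => _; [exact: cE|exact: cE'].
  have [q qN Ec] := KP c cK; have [q' qN' Ec'] := KP c' cK'.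
  have [_ /(_ q' t qN')] := cl q qN; rewrite /swop -/T -Ec -Ec'.
  have -> : (c t == t) || (c' t == t) by case: ht => ->; rewrite eqxx ?orbT.
  move=> ab x y z w; apply: leq_trans (ab x y z w) _.
  rewrite (unmatched_ext (g := restrict (keys x y z w) (switch (orb c c' t) c c'))) //.
  by move=> u; rewrite /restrict ffunE.
- exact: TK free_slot_lt.
- move=> c cK; rewrite -(unmatched_ext (res _ (KM c cK))).
  exact: (self c cK ord_max ord_max ord_max ord_max).
Qed.

Definition total s : nat := \sum_(q < N ^ 4) #|unmatched (tab s q)|.

(** Every pass that improves a slot lowers the potential [total]. Slots never get worse, so what a
    stable table guarantees survives all later passes and stability is not tested for. *)
Lemma passes_iter k s : table_ok s -> let s' := iter k (sem inp Pass) s in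
  [/\ table_ok s', (forall q, q < N ^ 4 -> #|unmatched (tab s' q)| <= #|unmatched (tab s q)|)
    & (exists s0, [/\ table_ok s0, closed_table R (tab s0) &
        forall q, q < N ^ 4 -> #|unmatched (tab s' q)| <= #|unmatched (tab s0 q)|])
      \/ total s' + k <= total s].
Proof.
move=> hok; elim: k => [|k]; first by split=> //; right; rewrite addn0.
rewrite iterS; move: (iter k _ s) => s1; cbv zeta => -[ok1 le1 or1].
have pr1 : progress R (tab s1) True s1 by split=> //; right.
have := pass_spec R_lt pr1; move: (sem inp Pass s1) => s2 [ok2 le2 or2].
split=> // [q qN|]; first by rewrite (leq_trans (le2 q qN)) // le1.
case: or1 => [[s0 [ok0 cl0 le0]]|tot].
  by left; exists s0; split=> // q qN; rewrite (leq_trans (le2 q qN)) // le0.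
case: or2 => [[q qN lt]|[_ cl]]; last by left; exists s1.
right; apply: leq_trans tot; rewrite addnS -addSn leq_add2r.
rewrite /total (bigD1 (Ordinal qN)) //= [X in _ <= X](bigD1 (Ordinal qN)) //= -addSn.
by apply: leq_add => //; apply: leq_sum => i _; apply: le2.
Qed.

Lemma passes_spec s : table_ok s ->
  let s' := sem inp Passes s in
  table_ok s' /\ forall m : 'I_N -> 'I_N, matching edge m ->
    #|unmatched (tab s' free_slot)| <= #|unmatched m|.
Proof.
move=> hok; rewrite /Passes sem_seq sem_rep -iterS.
(* The potential is at most [N ^ 5], a sum over [N ^ 4] slots of at most [N] unmatched vertices, so
   it cannot drop [N ^ 5 + 1] times. *)
have [ok' _ [[s0 [ok0 cl0 le0]]|tot]] := passes_iter (N ^ 5).+1 hok.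
  split=> // m mM; apply: leq_trans (le0 _ free_slot_lt) _; exact: closed_maximum.
have : total s <= N ^ 5.
  have -> : N ^ 5 = \sum_(q < N ^ 4) N by rewrite sum_nat_const card_ord expnSr.
  by apply: leq_sum => q _; rewrite (leq_trans (max_card _)) // card_ord.
by rewrite leqNgt (leq_trans (leq_addl _ _) tot).
Qed.

End Maximum.

(** The content of a register that starts as [d] and is overwritten by a loop at every hit of
    [P]. *)
Fixpoint last_index (d : nat) (f : nat -> nat) (P : pred nat) (k : nat) : nat :=
  if k is k'.+1 then if P k' then f k' else last_index d f P k' else d.

Lemma last_indexP d f (P : pred nat) k :
  (exists2 i, i < k /\ P i & last_index d f P k = f i) \/
  ((forall i, i < k -> ~~ P i) /\ last_index d f P k = d).
Proof.
elim: k => [|k IH] /=; first by right.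
case: ifP => Pk; first by left; exists k.
case: IH => [[i [ik Pi] E]|[H E]]; [left; exists i|right] => //; first by split=> //; lia.
by split=> // i; rewrite ltnS leq_eqVlt => /orP[/eqP->|/H//]; rewrite Pk.
Qed.

Lemma eq_last_index d f P P' k : P =1 P' -> last_index d f P k = last_index d f P' k.
Proof. by move=> E; elim: k => //= k ->; rewrite E. Qed.

(** * Naming the bigrams and turning a matching into positions *)

Definition FindRep : cmd :=
  For vJ 1 (Const 1) (For vK 1 (Const 1)
    (If (Plus (Var vK) (Const 1)) Len
      (If (Plus (Dist (Input (Var vK)) (Input (Var vJ)))
                (Dist (Input (Plus (Var vK) (Const 1))) (Input (Plus (Var vJ) (Const 1))))) (Const 1)
        (Store aRep (Var vJ) (Var vK)) Skip) Skip)).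

Definition InitTable : cmd :=
  For vP 4 LenS (Fill aTab (Var vP) (Const 0) (Const 0) (Var vI)).

(** The loop with empty body only computes [N ^ 4 * N]; one row less is the offset of the last slot,
    which is [free_slot]. *)
Definition Extract : cmd :=
  Seq (For vP 4 LenS Skip)
  (Fill aCand (Const 0) (Const 0) (Const 0)
     (Get aTab (Plus (Minus (Var vP) LenS) (Var vI)))).

Definition Mate : expr := Get aCand (Var vJ).
Definition RepK : expr := Get aRep (Var vK).
Definition RepK1 : expr := Get aRep (Plus (Var vK) (Const 1)).

Definition MarkPosition : cmd :=
  Seq (Assign vH (Var vJ))
  (Seq (For vK 1 (Const 1)
    (If (Plus (Var vK) (Const 2)) Len
      (If (Const 0)
         (Plus (Minus (Const 1) (Plus (Dist RepK (Var vJ)) (Dist RepK1 Mate)))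
               (Minus (Const 1) (Plus (Dist RepK Mate) (Dist RepK1 (Var vJ)))))
         (Assign vH (Plus (Var vK) (Const 1))) Skip) Skip))
  (Store aOut (Var vH) (Const 1))).

Definition MarkPositions : cmd :=
  For vJ 1 (Const 1)
    (If (Plus (Var vJ) (Const 1)) Len
      (If (Plus (Dist (Get aRep (Var vJ)) (Var vJ)) (Minus (Var vJ) Mate)) (Const 1)
         MarkPosition Skip) Skip).

Definition Output : cmd :=
  For vJ 1 (Const 1)
    (If (Const 0) (Get aOut (Var vJ)) (Write (Plus (Var vJ) (Const 1))) Skip).

Definition Attractor : cmd :=
  Seq FindRep (Seq InitTable (Seq Passes (Seq Extract (Seq MarkPositions Output)))).

(** * The complete program *)

Lemma dist2_eq0 a b c d :
  (a - b + (b - a) + (c - d + (d - c)) == 0) = (a == b) && (c == d).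
Proof. by rewrite addn_eq0 !dist_eq0. Qed.

Section Phases.
Variable inp : seq nat.
Local Notation n := (size inp).
Local Notation N := (size inp).+1.
Implicit Types s : state.

Definition same_bigram (k i : nat) : bool :=
  (nth 0 inp k == nth 0 inp i) && (nth 0 inp k.+1 == nth 0 inp i.+1).

(** The bound keeps out false matches past the end, where [nth] yields 0, which is also a letter. *)
Definition occurrence (i k : nat) : bool := (k.+1 < n) && same_bigram k i.

Definition repr (i : nat) : nat := last_index 0 id (occurrence i) N.

Lemma repr_lt i : repr i < N.
Proof. by rewrite /repr; case: (last_indexP 0 id (occurrence i) N) => [[j [jN _] ->]|[_ ->]]. Qed.

Lemma reprP i : i.+1 < n -> (repr i).+1 < n /\ same_bigram (repr i) i.
Proof.
move=> iN; rewrite /repr; case: (last_indexP 0 id (occurrence i) N) => [[j [_ /andP[jn js]] ->]//|[H _]].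
by have /negP[] := H i (ltn_trans (ltnW iN) (ltnSn _)); rewrite /occurrence iN /same_bigram !eqxx.
Qed.

Lemma repr_eq i j : same_bigram i j -> repr i = repr j.
Proof. by case/andP => /eqP E1 /eqP E2; apply: eq_last_index => k; rewrite /occurrence /same_bigram E1 E2. Qed.

Lemma find_rep_spec s i : (forall j, arr s aRep j = 0) -> i < N ->
  arr (sem inp FindRep s) aRep i = repr i.
Proof.
move=> s0.
pose I k s' := forall i, arr s' aRep i = if i < k then repr i else 0.
suff : I (N ^ 1) (sem inp FindRep s) by rewrite expn1 => H iN; rewrite H iN.
apply: (@for_rule inp vJ 1 (Const 1) 1 _ I) => // k s1 kN; rewrite muln1 => sk Ik.
pose I' l s' := arr s' vJ 0 = k /\ forall i, arr s' aRep i =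
  if i == k then last_index 0 id (occurrence k) l
  else arr s1 aRep i.
set c := For vK _ _ _.
suff [_ H] : I' (N ^ 1) (sem inp c s1).
  move: (sem inp c s1) H => s2; rewrite expn1 => H j.
  rewrite -[LHS]/(arr s2 aRep j) H Ik.
  have [->|jk] := eqVneq j k; first by rewrite ltnSn.
  by rewrite [j < k.+1]ltnS [j <= k]leq_eqVlt (negPf jk).
apply: (@for_rule inp vK 1 (Const 1) 1 _ I') => //.
  by split=> // j; rewrite /= Ik; have [->|//] := eqVneq j k; rewrite ltnn.
move=> l s2 lN; rewrite muln1 => sl [sk2 H].
rewrite /= sl sk2 !addn1; split.
  by do 2!case: ifP => _ //=.
move=> j; rewrite ltnS leqn0 addn_eq0 !dist_eq0 -/(same_bigram l k).
rewrite /= /occurrence; case: ltnP => ln /=; last by rewrite H.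
case: ifP => _ /=; last by rewrite H.
by rewrite H; case: (j == k).
Qed.

Lemma init_table_spec s q v : q < N ^ 4 -> v < N ->
  arr (sem inp InitTable s) aTab (q * N + v) = v.
Proof.
pose I k s' := forall q v, q < k -> v < N -> arr s' aTab (q * N + v) = v.
suff : I (N ^ 4) (sem inp InitTable s) by move=> H; apply: H.
apply: (@for_rule inp vP 4 LenS N _ I) => //; first by move=> s'; rewrite /= addn1.
move=> k s1 kN sp Ik q' v'; rewrite ltnS leq_eqVlt => qk vN.
rewrite -[LHS]/(arr (sem inp (Fill _ _ _ _ _) s1) _ _).
rewrite (@fill_spec _ _ _ _ _ _ _ (k * N) id) //; last first.
  by move=> i s' iN ag si; split; [rewrite /= ag | rewrite /= si].
rewrite block_range //; case/orP: qk => [/eqP->|qk]; first by rewrite eqxx addKn.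
by rewrite (ltn_eqF qk) Ik.
Qed.

Lemma extract_spec s (v : 'I_N) : table_ok inp repr s ->
  arr (sem inp Extract s) aCand v = tab inp s (free_slot inp) v.
Proof.
move=> hok; rewrite /Extract sem_seq.
set s1 := sem inp (For _ _ _ _) s.
have sp : arr s1 vP 0 = N ^ 4 * N.
  apply: (@for_rule inp vP 4 LenS N _ (fun k s' => arr s' vP 0 = k * N)) => //.
  by move=> s'; rewrite /= addn1.
have st j : arr s1 aTab j = arr s aTab j by rewrite /s1 sem_frame.
move: s1 sp st => s1 sp st.
rewrite (@fill_spec _ _ _ _ _ _ _ 0 (fun v => nat_of_ord (tab inp s (free_slot inp) (inord v)))) //.
  by rewrite add0n leq0n ltn_ord subn0 inord_val.
move=> i s' iN ag si; split=> //; rewrite /= si !ag // sp addn1 st.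
rewrite -(tabE (inord i) hok (free_slot_lt inp)) inordK //.
have -> // : N ^ 4 * N - N = free_slot inp * N.
have -> : N ^ 4 = (free_slot inp).+1.
  by rewrite /free_slot /quad -addnS -mulSnr -addnS -mulSnr -addnS -mulSnr !expnSr expn0 mul1n.
by rewrite mulSn addKn.
Qed.

Definition joins (j j' k : nat) : bool := (k.+2 < n) &&
  ((repr k == j) && (repr k.+1 == j') || (repr k == j') && (repr k.+1 == j)).

(** A position counted from 0: the letter shared by overlapping occurrences of the two bigrams or,
    if there are none, the first letter of [j] itself. *)
Definition chosen (j j' : nat) : nat := last_index j succn (joins j j') N.

(** One bigram for each member of the edge cover: the smaller end of every edge of [m], and every
    unmatched bigram. *)
Definition selected (m : 'I_N -> 'I_N) (j : 'I_N) : bool :=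
  [&& j.+1 < n, repr j == j & j <= m j].

Lemma mark_position_spec s j j' : arr s vJ 0 = j -> arr s aCand j = j' ->
  (forall i, i < N -> arr s aRep i = repr i) ->
  forall v, arr (sem inp MarkPosition s) aOut v =
    if v == chosen j j' then 1 else arr s aOut v.
Proof.
move=> sj sm sr; rewrite /MarkPosition 2!sem_seq sem_assign.
set s1 := set_arr _ _ _ _; set s2 := sem inp (For _ _ _ _) s1.
pose I k s' := arr s' vH 0 = last_index j succn (joins j j') k /\
  forall a i, a \notin [:: vH; vK] -> arr s' a i = arr s a i.
suff [h2 f2] : I (N ^ 1) s2.
  by move: s2 h2 f2 => s2; rewrite expn1 => h2 f2 v /=; rewrite h2 f2.
apply: (@for_rule inp vK 1 (Const 1) 1 _ I) => //.
  split; first by rewrite /= sj.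
  by move=> a i; rewrite !inE => /norP[/negPf h1 /negPf h2] /=; rewrite h1 h2.
rewrite expn1 => k s' kN; rewrite muln1 => sk [sh sf].
set s3 := sem inp (If _ _ _ _) s'.
have f3 a i : a \notin [:: vH; vK] -> arr s3 a i = arr s a i.
  by move=> h; rewrite /s3 sem_frame ?sf //; apply: notin_sub h _.
have h3 : arr s3 vH 0 = last_index j succn (joins j j') k.+1.
  rewrite /s3 /= /joins sk addn2 addn1; case: ltnP => k2 /=; last by rewrite sh.
  have [jj mm] : arr s' vJ 0 = j /\ arr s' aCand j = j' by split; rewrite sf.
  have [r1 r2] : arr s' aRep k = repr k /\ arr s' aRep k.+1 = repr k.+1.
    by split; rewrite sf // sr //; lia.
  rewrite jj mm r1 r2 addn_gt0 !subn_gt0 !ltnS !leqn0 !dist2_eq0.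
  by case: ifP => _ /=; rewrite ?sh.
move: s3 f3 h3 => s3 f3 h3; split; first by rewrite /= h3.
move=> a i h; have := h; rewrite !inE => /norP[_ /negPf hk] /=.
by rewrite hk /= f3.
Qed.

Lemma mark_positions_spec s (m : 'I_N -> 'I_N) :
  (forall i, i < N -> arr s aRep i = repr i) -> (forall v : 'I_N, arr s aCand v = m v) ->
  (forall v, arr s aOut v = 0) -> forall v,
  (0 < arr (sem inp MarkPositions s) aOut v) =
    [exists j : 'I_N, selected m j && (chosen j (m j) == v)].
Proof.
move=> sr sc s0.
pose I k s' := [/\ (forall v, (0 < arr s' aOut v) =
    [exists j : 'I_N, [&& j < k, selected m j & chosen j (m j) == v]]),
  (forall i, i < N -> arr s' aRep i = repr i) & (forall v : 'I_N, arr s' aCand v = m v)].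
suff [H _ _] : I (N ^ 1) (sem inp MarkPositions s).
  by move=> v; rewrite H expn1; apply: eq_existsb => j; rewrite ltn_ord.
apply: (@for_rule inp vJ 1 (Const 1) 1 _ I) => //.
  by split=> // v; rewrite /= s0; apply/esym/existsP => -[].
rewrite expn1 => k s1 kN; rewrite muln1 => sk [H1 r1 c1].
set c := If _ _ _ _; set s2 := sem inp c s1.
have r2 i : i < N -> arr s2 aRep i = repr i by move=> iN; rewrite /s2 sem_frame ?r1.
have c2 (v : 'I_N) : arr s2 aCand v = m v by rewrite /s2 sem_frame ?c1.
pose K := Ordinal kN.
have cK : arr s1 aCand k = m K by rewrite -c1.
have H2 v : (0 < arr s2 aOut v) = (selected m K && (chosen k (m K) == v)) || (0 < arr s1 aOut v).
  have M := mark_position_spec sk cK r1 v.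
  have cond1 : (eval inp (Plus (Var vJ) (Const 1)) s1 < eval inp Len s1) = (k.+1 < n).
    by rewrite /= sk addn1.
  have cond2 : (eval inp (Plus (Dist (Get aRep (Var vJ)) (Var vJ)) (Minus (Var vJ) Mate)) s1 <
      eval inp (Const 1) s1) = (repr k == k) && (k <= m K).
    by rewrite /= sk cK r1 // ltnS leqn0 addn_eq0 dist_eq0 subn_eq0.
  rewrite /s2 /c 2!sem_if cond1 cond2 -[sem inp Skip s1]/s1.
  move: (sem inp MarkPosition s1) M => s3 M.
  rewrite /selected; case: (ltnP k.+1 n) => // k1.
  rewrite -[nat_of_ord K]/k andTb; case: andP => // _.
  by rewrite M eq_sym; case: eqP.
move: s2 r2 c2 H2 => s2 r2 c2 H2; split=> // v /=.
rewrite H2 H1; apply/orP/existsP => [[/andP[h1 h2]|/existsP[j /and3P[h1 h2 h3]]]|[j /and3P[h1 h2 h3]]].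
- by exists K; rewrite ltnSn h1 h2.
- by exists j; rewrite ltnW ?h2.
- move: h1; rewrite ltnS leq_eqVlt => /orP[/eqP E|h1]; [left|right].
    have jK : j = K by apply: val_inj.
    by rewrite jK in h2 h3; apply/andP.
  by apply/existsP; exists j; rewrite h1 h2 h3.
Qed.

Lemma output_spec s :
  out (sem inp Output s) = out s ++ [seq v.+1 | v <- iota 0 N & 0 < arr s aOut v].
Proof.
pose I k s' := (forall v, arr s' aOut v = arr s aOut v) /\
  out s' = out s ++ [seq v.+1 | v <- iota 0 k & 0 < arr s aOut v].
suff [_] : I (N ^ 1) (sem inp Output s) by rewrite expn1.
apply: (@for_rule inp vJ 1 (Const 1) 1 _ I) => //; first by split; rewrite /= ?cats0.
rewrite expn1 => k s' kN; rewrite muln1 => sk [so sout]; split=> [v|].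
  by rewrite /= sk so; case: ifP => _ /=; rewrite so.
have -> : iota 0 k.+1 = iota 0 k ++ [:: k] by rewrite -[k.+1]addn1 iotaD.
rewrite filter_cat map_cat catA -sout /= sk so addn1.
by case: ifP => _ /=; rewrite ?cats0 ?cats1.
Qed.

Lemma attractor_spec : exists m : 'I_N -> 'I_N,
  [/\ matching (@edge inp repr) m,
      (forall m' : 'I_N -> 'I_N, matching (@edge inp repr) m' -> #|unmatched m| <= #|unmatched m'|)
    & out (sem inp Attractor (State (fun _ _ => 0) [::])) =
        [seq v.+1 | v <- iota 0 N &
          [exists j : 'I_N, selected m j && (chosen j (m j) == v)]]].
Proof.
rewrite /Attractor 5!sem_seq; set s0 := State _ _.
set s1 := sem inp FindRep s0.
have r1 i : i < N -> arr s1 aRep i = repr i by apply: find_rep_spec.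
have o1 v : arr s1 aOut v = 0 by rewrite /s1 sem_frame.
have out1 : out s1 = [::] by rewrite /s1 sem_silent.
move: s1 r1 o1 out1 => s1 r1 o1 out1.
set s2 := sem inp InitTable s1.
have ok2 : table_ok inp repr s2.
  have T q : q < N ^ 4 -> tab inp s2 q =1 id.
    by move=> qN v; rewrite ffunE init_table_spec // inord_val.
  split=> [i iN|q v qN vN|q qN|x y z w v _].
  - by rewrite /s2 sem_frame ?r1.
  - by rewrite init_table_spec.
  - by split=> v; rewrite !T // eqxx.
  - by rewrite T // quad_lt.
have o2 v : arr s2 aOut v = 0 by rewrite /s2 sem_frame.
have out2 : out s2 = [::] by rewrite /s2 sem_silent.
move: s2 ok2 o2 out2 => s2 ok2 o2 out2 {s1 r1 o1 out1}.
have repr_valid i : i.+1 < n -> repr i < n by move=> /reprP[/ltnW].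
have := passes_spec repr_lt repr_valid ok2.
have o3 v : arr (sem inp Passes s2) aOut v = 0 by rewrite sem_frame.
have out3 : out (sem inp Passes s2) = [::] by rewrite sem_silent.
move: (sem inp Passes s2) o3 out3 => s3 o3 out3; cbv zeta => -[ok3 max3].
exists (tab inp s3 (free_slot inp)); split=> //; first exact: (ok_matching ok3 (free_slot_lt inp)).
set s4 := sem inp Extract s3.
have c4 (v : 'I_N) : arr s4 aCand v = tab inp s3 (free_slot inp) v by apply: extract_spec.
have o4 v : arr s4 aOut v = 0 by rewrite /s4 sem_frame.
have out4 : out s4 = [::] by rewrite /s4 sem_silent.
have r4 i : i < N -> arr s4 aRep i = repr i.
  by move=> iN; rewrite /s4 sem_frame // (ok_rep ok3).
move: s4 c4 o4 out4 r4 => s4 c4 o4 out4 r4.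
rewrite output_spec sem_silent // out4 cat0s; congr map; apply: eq_filter => v.
exact: mark_positions_spec.
Qed.

End Phases.

(** * Attractors as edge covers *)

Section EdgeCover.
Variable inp : seq nat.
Local Notation n := (size inp).
Local Notation N := (size inp).+1.
Local Notation repr := (repr inp).
Local Notation edge := (@edge inp repr).
Implicit Types (m : 'I_N -> 'I_N) (u v w : 'I_N) (Gamma : {fset nat}).

Definition is_rep (v : 'I_N) : bool := (v.+1 < n) && (repr v == v).

Lemma repr_ord b : b.+1 < n -> exists2 v : 'I_N, is_rep v & repr b = v.
Proof.
move=> bn; have [vn sb] := reprP bn.
exists (Ordinal (repr_lt inp b)) => //; rewrite /is_rep /= vn /=.
by apply/eqP; apply: repr_eq.
Qed.

Lemma same_bigram_repr i j : i.+1 < n -> j.+1 < n -> repr i = repr j -> same_bigram inp i j.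
Proof.
move=> iN jN E; have [_ /andP[/eqP a1 /eqP a2]] := reprP iN.
have [_ /andP[/eqP b1 /eqP b2]] := reprP jN.
by rewrite /same_bigram -a1 -a2 E b1 b2 !eqxx.
Qed.

Lemma edge_is_rep u v : edge u v -> is_rep u.
Proof.
case/andP => _ /existsP[g /andP[g2 /orP[]/andP[/eqP e1 /eqP e2]]].
  have [w wr E] := repr_ord (ltnW g2); have <- // : w = u.
  by apply: val_inj; rewrite /= -E.
have [w wr E] := repr_ord g2; have <- // : w = u.
by apply: val_inj; rewrite /= -E.
Qed.

(** The representatives that are not selected are the larger ends of the edges of [m], since only
    representatives have edges. *)
Lemma card_selected m : matching edge m ->
  #|[set j | selected m j]| + \sum_(i < N) (i < m i) = #|[set v | is_rep v]|.
Proof.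
move=> [mK mE].
have -> : \sum_(i < N) (i < m i) = #|[set i : 'I_N | m i < i]|.
  rewrite (reindex_inj (inv_inj mK)) -sum1_card [RHS]big_mkcond.
  by apply: eq_bigr => i _; rewrite inE mK; case: ifP.
rewrite -(cardsID [set i : 'I_N | m i < i] [set v | is_rep v]) addnC; congr (_ + _).
  apply: eq_card => i; rewrite !inE; apply/idP/andP => [lt|[]//]; split=> //.
  by apply: (@edge_is_rep _ (m i)); apply: mE; rewrite neq_ltn lt.
by apply: eq_card => i; rewrite !inE -leqNgt /selected /is_rep andbA andbC.
Qed.

Lemma selected_min m m' : matching edge m -> matching edge m' ->
  #|unmatched m| <= #|unmatched m'| ->
  #|[set j | selected m j]| <= #|[set j | selected m' j]|.
Proof.
move=> mM mM'; move: (card_selected mM) (card_selected mM').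
move: (card_unmatched_size (proj1 mM)) (card_unmatched_size (proj1 mM')).
move: (\sum_(i < N) (i < m i)) (\sum_(i < N) (i < m' i)) => a b.
move: #|unmatched m| #|unmatched m'| #|[set j | selected m j]| #|[set j | selected m' j]|.
by move: #|[set v | is_rep v]| => ? ? ? ? ?; clear; lia.
Qed.

Lemma substring_bigram b : b.+1 < n ->
  substring inp b.+1 b.+2 = [:: nth 0 inp b; nth 0 inp b.+1].
Proof.
move=> bn; rewrite /substring /=.
have sz : size (take b.+2 inp) = b.+2 by rewrite size_takel.
rewrite (drop_nth 0) ?sz // (drop_nth 0) ?sz // !nth_take //.
by rewrite drop_oversize // sz.
Qed.

Lemma bigram_occurrence b i' j' : b.+1 < n -> 1 <= i' -> i' <= j' -> j' <= n ->
  substring inp i' j' = substring inp b.+1 b.+2 ->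
  exists2 b', i' = b'.+1 /\ j' = b'.+2 & same_bigram inp b' b.
Proof.
move=> bn i1 ij jn E.
have Ej : j' = i'.+1.
  have := congr1 size E; rewrite (substring_bigram bn) /substring size_drop size_takel //=.
  by lia.
case: i' i1 ij E Ej => // b' _ _ E Ej; rewrite Ej in jn E *.
exists b' => //; move: E; rewrite !substring_bigram // => -[e1 e2].
by rewrite /same_bigram e1 e2 !eqxx.
Qed.

(** Here [p] counts from 1 and [b] from 0, so the occurrence at [b] occupies the positions [b.+1]
    and [b.+2]. *)
Definition covers (p : nat) (v : 'I_N) : bool :=
  [exists b : 'I_N, [&& b.+1 < n, repr b == v & (p == b.+1) || (p == b.+2)]].

Lemma attractor_covers Gamma v : sharp_attractor 2 inp Gamma -> is_rep v ->
  exists p : 'I_N, (val p \in Gamma) && covers p v.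
Proof.
move=> [Grange Gcov] /andP[vn /eqP vr].
have [||i' [j' [i1 ij jn E [p pG /andP[ip pj]]]]] := Gcov v.+1 v.+2 isT (leqnSn _) => //.
  by lia.
have [b [Ei Ej] sb] := bigram_occurrence vn i1 ij jn E; subst i' j'.
have /andP[_ pn] := Grange p pG.
exists (Ordinal (pn : p < N)); rewrite /= pG /=; apply/existsP.
have bN : b < N by lia.
exists (Ordinal bN); rewrite /= jn -vr -(repr_eq sb) eqxx /=.
by apply/orP; case: (eqVneq p b.+1) => [_|h]; [left|right; lia].
Qed.

Lemma covers_edge p v w : covers p v -> covers p w -> v != w -> edge v w.
Proof.
move=> /existsP[b /and3P[bn /eqP bv bp]] /existsP[c /and3P[cn /eqP cw cp]] vw.
rewrite /edge vw /=; apply/existsP.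
have bc : b != c :> nat.
  by apply: contraNneq vw => bc; apply/eqP/val_inj; rewrite /= -bv -cw bc.
have [E|E] : b.+1 = c \/ c.+1 = b by lia.
  by exists b; rewrite E cn bv cw !eqxx.
by exists c; rewrite E bn bv cw !eqxx orbT.
Qed.

(** Only two bigram occurrences can contain a given position. *)
Lemma covers_two p u v w : covers p u -> covers p v -> covers p w ->
  u != v -> u != w -> v = w.
Proof.
move=> /existsP[a /and3P[_ /eqP au ap]] /existsP[b /and3P[_ /eqP bv bp]].
move=> /existsP[c /and3P[_ /eqP cw cp]] uv uw.
have ab : a != b :> nat.
  by apply: contraNneq uv => E; apply/eqP/val_inj; rewrite /= -au -bv E.
have ac : a != c :> nat.
  by apply: contraNneq uw => E; apply/eqP/val_inj; rewrite /= -au -cw E.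
have bc : b = c :> nat by move: ap bp cp ab ac; clear; lia.
by apply: val_inj; rewrite /= -bv -cw bc.
Qed.

(** Assign to each bigram a position of [Gamma] that covers it. At most two bigrams share a
    position, and those that do overlap there, so matching them uses edges of the graph. *)
Lemma attractor_matching Gamma : sharp_attractor 2 inp Gamma ->
  exists2 m, matching edge m & #|[set j | selected m j]| <= #|` Gamma|.
Proof.
move=> GA.
pose pos v : 'I_N := if [pick p : 'I_N | (val p \in Gamma) && covers p v] is Some p then p else ord0.
have posP v : is_rep v -> val (pos v) \in Gamma /\ covers (pos v) v.
  move=> vr; rewrite /pos; case: pickP => [p /andP[]//|H].
  by have [p] := attractor_covers GA vr; rewrite H.
pose rel v w := [&& is_rep v, is_rep w, w != v & pos w == pos v].
pose m v := if [pick w | rel v w] is Some w then w else v.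
have mP v : m v = v \/ rel v (m v).
  by rewrite /m; case: pickP => [w|_]; [right|left].
have relP v w : rel v w -> m v = w.
  move=> vw; rewrite /m; case: pickP => [w' vw'|/(_ w)]; last by rewrite vw.
  case/and4P: vw => vr wr wv /eqP pw; case/and4P: vw' => _ wr' wv' /eqP pw'.
  have [_ cv] := posP v vr; have [_ cw] := posP w wr; have [_ cw'] := posP w' wr'.
  rewrite pw in cw; rewrite pw' in cw'.
  by apply: (covers_two cv cw' cw); rewrite eq_sym.
have rel_sym v w : rel v w -> rel w v.
  by case/and4P => vr wr wv pw; rewrite /rel vr wr eq_sym wv eq_sym pw.
exists m.
  split=> [v|v]; first by case: (mP v) => [E|/rel_sym/relP//]; rewrite !E.
  case: (mP v) => [->|]; first by rewrite eqxx.
  case/and4P => vr wr wv /eqP pw _.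
  have [_ cv] := posP v vr; have [_ cw] := posP _ wr; rewrite pw in cw.
  by apply: covers_edge cv cw _; rewrite eq_sym.
have sel_rep j : j \in [set j | selected m j] -> is_rep j /\ j <= m j.
  by rewrite inE => /and3P[h1 h2 h3]; rewrite /is_rep h1 h2.
(* [pos] is injective on selected bigrams: two bigrams with one position are matched to each other,
   and only the smaller is selected. *)
rewrite -(card_in_imset (f := pos)).
  rewrite cardE -(size_map val); apply: uniq_leq_size.
    by rewrite map_inj_uniq ?enum_uniq //; exact: val_inj.
  move=> p /mapP[q]; rewrite mem_enum => /imsetP[j /sel_rep[jr _] ->] ->.
  by have [] := posP j jr.
move=> j k /sel_rep[jr jm] /sel_rep[kr km] pjk; apply/eqP/negPn/negP => jk.
have rjk : rel j k by rewrite /rel jr kr eq_sym jk pjk eqxx.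
move: jm km; rewrite (relP _ _ rjk) (relP _ _ (rel_sym _ _ rjk)) => h1 h2.
by move: jk; rewrite -(inj_eq val_inj) eqn_leq h1 h2.
Qed.

Section Positions.
Variable m : 'I_N -> 'I_N.
Hypothesis mM : matching edge m.
Let positions : seq nat := [seq p.+1 | p <- iota 0 N &
  [exists j : 'I_N, selected m j && (chosen inp j (m j) == p)]].

Lemma positions_uniq : uniq positions.
Proof. by rewrite map_inj_uniq ?filter_uniq ?iota_uniq // => ? ? []. Qed.

Lemma mem_positions p : reflect (exists2 j, selected m j & p = (chosen inp j (m j)).+1)
  ((p \in positions)).
Proof.
apply: (iffP mapP) => [[v]|[j sj ->]].
  by rewrite mem_filter => /andP[/existsP[j /andP[sj /eqP <-]] _] ->; exists j.
exists (chosen inp j (m j)) => //; rewrite mem_filter mem_iota /= add0n.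
apply/andP; split; first by apply/existsP; exists j; rewrite sj eqxx.
rewrite /chosen; case: (last_indexP j succn (joins inp j (m j)) N) => [[k [_ /andP[k2 _]] ->]|[_ ->]] //.
by lia.
Qed.

Lemma card_positions : #|` [fset x in positions]%fset| <= #|[set j | selected m j]|.
Proof.
rewrite card_fseq undup_id ?positions_uniq //.
rewrite cardE -(size_map (fun j : 'I_N => (chosen inp j (m j)).+1)).
apply: uniq_leq_size positions_uniq _ => p /mem_positions[j sj ->].
by apply/mapP; exists j; rewrite // mem_enum inE.
Qed.

Lemma positions_attractor : sharp_attractor 2 inp [fset x in positions]%fset.
Proof.
have [mK mE] := mM.
(* If no [k] joins [j] to its mate, there is no edge between them, so [j] is unmatched. *)
have chosenP j : selected m j ->
    (exists2 k, joins inp j (m j) k & chosen inp j (m j) = k.+1) \/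
    (m j = j /\ chosen inp j (m j) = j).
  move=> sj; rewrite /chosen.
  case: (last_indexP j succn (joins inp j (m j)) N) => [[k [_ jk] ->]|[H ->]]; [left; by exists k|right].
  split=> //; apply/eqP/negPn/negP => /mE/andP[_ /existsP[g jg]].
  by have /negP[] := H g (ltn_ord g).
split.
  move=> p; rewrite in_fset => /mem_positions[j sj ->] /=.
  case: (chosenP j sj) => [[k /andP[k2 _] ->]|[_ ->]]; first lia.
  by case/and3P: sj => jn _ _; lia.
move=> i j i1 ij jn ji.
have [b Ei Ej] : exists2 b, i = b.+1 & j = b.+2 by exists i.-1; lia.
subst i j; have [v vr bv] := repr_ord jn; have /andP[vn /eqP vv] := vr.
(* [u] is whichever of [v] and its mate is selected; its chosen position lies in an occurrence of
   the bigram [v]. *)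
have [u su uv] : exists2 u, selected m u & v = u \/ v = m u.
  case: (leqP v (m v)) => vm; first by exists v; [rewrite /selected vn vv eqxx | left].
  have mr : is_rep (m v).
    by apply: (@edge_is_rep _ v); rewrite edge_sym; apply: mE; rewrite neq_ltn vm.
  have /andP[h1 h2] := mr.
  by exists (m v); [rewrite /selected h1 h2 mK ltnW | right; rewrite mK].
have occ b' : b'.+1 < n -> repr b' = v -> b' < (chosen inp u (m u)).+1 <= b'.+2 ->
  exists i' j' : nat, [/\ 1 <= i', i' <= j', j' <= n,
    substring inp i' j' = substring inp b.+1 b.+2 &
    exists2 j'' : nat, j'' \in [fset x in positions]%fset & i' <= j'' <= j'].
  move=> bn' bv' hc; exists b'.+1, b'.+2; split=> //.
    have /andP[/eqP e1 /eqP e2] := same_bigram_repr bn' jn (etrans bv' (esym bv)).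
    by rewrite !substring_bigram // e1 e2.
  exists (chosen inp u (m u)).+1 => //.
  by rewrite in_fset; apply/mem_positions; exists u.
case: (chosenP u su) => [[k jk Ec]|[mu Ec]].
  case/andP: jk => k2 jk.
  have [kv|kv] : repr k = v \/ repr k.+1 = v.
    by case: uv => ->; case/orP: jk => /andP[/eqP-> /eqP->]; [left|right|right|left].
    by apply: (occ k) => //; rewrite ?Ec; lia.
  by apply: (occ k.+1) => //; rewrite ?Ec; lia.
have uv' : v = u by case: uv => [//|]; rewrite mu.
by apply: (occ v) => //; rewrite Ec uv'; lia.
Qed.

End Positions.
End EdgeCover.

Theorem theorem35 : polytime_solvable (compute_minimum_sharp_attractor 2).
Proof.
(* Array names go up to 22, and [cmd_ok] demands [a.+1 < K]. *)
apply: (@compile_polytime _ Attractor 24) => // inp.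
have [m [mM mmax ->]] := attractor_spec inp.
split; first exact: positions_uniq.
split; first exact: positions_attractor.
move=> Gamma GA; have [m' mM' le] := attractor_matching GA.
apply: leq_trans (card_positions _) (leq_trans _ le).
by apply: selected_min => //; apply: mmax.
Qed.
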